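(* Let $(\mathcal{L},\mathcal{G})$ be a supersolvable built lattice. Then the algebra $\mathrm{FY}(\mathcal{L},\mathcal{G})$ admits a quadratic Gröbner basis.
   Context: A geometric lattice is a finite lattice $\mathcal{L}$ (least element $\hat 0$, greatest element $\hat 1$, join $\vee$, meet $\wedge$) in which all maximal chains between two comparable elements have the same cardinality, whose rank function $\rho$ satisfies $\rho(X\wedge Y)+\rho(X\vee Y)\le\rho(X)+\rho(Y)$, and in which every element is a join of atoms (elements of rank 1). A building set of $\mathcal{L}$ is a subset $\mathcal{G}\subset\mathcal{L}\setminus\{\hat 0\}$ such that for every $X\in\mathcal{L}$ the join map $\prod_{G\in\max\mathcal{G}_{\le X}}[\hat 0,G]\to[\hat 0,X]$ is an isomorphism of posets, where $\max\mathcal{G}_{\le X}$ is the set of maximal elements of $\mathcal{G}\cap[\hat 0,X]$. A built lattice is a pair $(\mathcal{L},\mathcal{G})$ with $\mathcal{L}$ a geometric lattice and $\mathcal{G}$ a building set of $\mathcal{L}$. A pair $(X,Y)$ of elements of $\mathcal{L}$ is modular if $Z\vee(X\wedge Y)=(Z\vee X)\wedge Y$ for every $Z\le Y$; an element $X$ is modular if $(X,Y)$ and $(Y,X)$ are modular for every $Y$. A built lattice $(\mathcal{L},\mathcal{G})$ is supersolvable if $\mathcal{L}$ has a maximal chain $\hat 0=G_1<\dots<G_n=\hat 1$ of modular elements, whose elements other than $\hat 0$ belong to $\mathcal{G}$, such that for every $G\in\mathcal{G}$ and every $i\le n$ one has $G_i\wedge G\in\mathcal{G}\cup\{\hat 0\}$.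 The Feichtner--Yuzvinsky ring is the graded commutative ring $\mathrm{FY}(\mathcal{L},\mathcal{G})=\mathbb{Z}[h_G,\ G\in\mathcal{G}]/\mathcal{I}_{\mathrm{wond}}$, where $\mathcal{I}_{\mathrm{wond}}$ is generated by $h_H$ for every atom $H$ and by $\prod_{G'\in\mathcal{A}}(h_G-h_{G'})$ for every $G\in\mathcal{G}$ and every antichain $\mathcal{A}$ in $\mathcal{G}$ with $\bigvee\mathcal{A}=G$. Each $h_G$ has weight 1 (cohomological degree 2). An algebra admits a quadratic Gröbner basis if it can be presented as the quotient of a polynomial ring on generators of weight 1 by a homogeneous ideal which, for some monomial order, has a Gröbner basis consisting of homogeneous elements of weight 2; over $\mathbb{Z}$ a Gröbner basis is understood with leading coefficients $\pm1$. (Here, the generators $h_H$ with $H$ an atom, which are zero, are discarded.) *)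

(* Defs.v *)
From HB Require Import structures.
From mathcomp Require Import all_boot all_order all_algebra.
From mathcomp Require Import boolp mpoly.

Set Implicit Arguments.
Unset Strict Implicit.
Unset Printing Implicit Defensive.

Import Order.TTheory GRing.Theory.

Local Open Scope ring_scope.

Section GeometricLattice.
Context {d : Order.disp_t} {L : finTBLatticeType d}.
Implicit Types (x y z : L) (C G : {set L}).

Definition is_chain_between x y C : bool :=
  [forall a in C, (x <= a <= y)%O] &&
  [forall a in C, forall b in C, (a >=< b)%O].

Definition is_maximal_chain x y C : bool := maxset (is_chain_between x y) C.

(* Length of a longest chain of [\bot, x]; in a geometric lattice, this is the
   common length of all the maximal chains of [\bot, x]. *)
Definition rank x : nat := (\max_(C | is_chain_between \bot%O x C) #|C|.-1)%N.

Definition is_atom x : bool := rank x == 1%N.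

Definition geometric : Prop :=
  [/\ forall x y C C', (x <= y)%O ->
        is_maximal_chain x y C -> is_maximal_chain x y C' -> #|C| = #|C'|,
      forall x y, (rank (x `&` y)%O + rank (x `|` y)%O <= rank x + rank y)%N
    & forall x, exists2 A : {set L},
        {in A, forall a, is_atom a} & x = (\join_(a in A) a)%O].

Definition max_below G x : {set L} :=
  [set g in G | (g <= x)%O &
     [forall h in G, ((h <= x) && (g <= h))%O ==> (h == g)]].

Definition interval_product G x :=
  {dffun forall g : {g : L | g \in max_below G x}, {y : L | (y <= val g)%O}}.

Definition join_map G x (f : interval_product G x) : L :=
  (\join_g val (f g))%O.

(* For each x, the two clauses say that join_map is an order embedding of the
   product poset, with image exactly [\bot, x]. *)
Definition building_set G : Prop :=
  \bot%O \notin G /\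
  forall x,
    (forall f f' : interval_product G x,
       (join_map f <= join_map f')%O <->
       (forall g, (val (f g) <= val (f' g))%O)) /\
    (forall y, (y <= x)%O <-> exists f : interval_product G x, join_map f = y).

Definition modular_pair x y : Prop :=
  forall z, (z <= y)%O -> (z `|` (x `&` y) = (z `|` x) `&` y)%O.

Definition modular_element x : Prop :=
  forall y, modular_pair x y /\ modular_pair y x.

End GeometricLattice.

Arguments geometric {d} L.

Record builtLattice (d : Order.disp_t) := BuiltLattice {
  lattice_of :> finTBLatticeType d;
  bset : {set lattice_of};
  built_geometric : geometric lattice_of;
  built_building : building_set bset
}.

Definition supersolvable d (B : builtLattice d) : Prop :=
  exists C : {set B},
    [/\ is_maximal_chain \bot%O \top%O C,
        {in C, forall c, modular_element c},
        {in C, forall c, c != \bot%O -> c \in bset B}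
      & forall g c, g \in bset B -> c \in C ->
          (c `&` g)%O \in bset B \/ (c `&` g = \bot)%O].

Section IdealGenerated.
Variable R : comNzRingType.

Definition ideal_gen (S : R -> Prop) (p : R) : Prop :=
  exists2 s : seq (R * R),
    (forall c, c \in s -> S c.2) & p = \sum_(c <- s) c.1 * c.2.

Lemma ideal_gen0 S : ideal_gen S 0.
Proof. by exists [::]; rewrite ?big_nil. Qed.

Lemma ideal_gen_lin S a u v :
  ideal_gen S u -> ideal_gen S v -> ideal_gen S (a * u + v).
Proof.
move=> [s Ss ->] [t St ->].
exists ([seq (a * c.1, c.2) | c <- s] ++ t) => [c|].
  by rewrite mem_cat => /orP[/mapP[e es ->]|/St//]; apply: Ss es.
rewrite big_cat big_map /= mulr_sumr; congr (_ + _).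
by apply: eq_bigr => c _; rewrite mulrA.
Qed.

End IdealGenerated.

Section FeichtnerYuzvinsky.
Context {d : Order.disp_t} (B : builtLattice d).

Definition bidx : finType := {g : B | g \in bset B}.

Definition nbidx : nat := #|{: bidx}|.

Definition hvar (g : bidx) : {mpoly int[nbidx]} := 'X_(enum_rank g).

Definition antichain (A : {set bidx}) : Prop :=
  {in A &, forall a b, (val a <= val b)%O -> a = b}.

Inductive wond_relation : {mpoly int[nbidx]} -> Prop :=
| WondAtom (a : bidx) of is_atom (val a) : wond_relation (hvar a)
| WondAntichain (g : bidx) (A : {set bidx}) of
    antichain A & (\join_(a in A) val a)%O = val g :
    wond_relation (\prod_(a in A) (hvar g - hvar a)).

Definition wond_ideal : pred {mpoly int[nbidx]} :=
  fun p => `[< ideal_gen wond_relation p >].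

Lemma wond_relation_coef0 p : wond_relation p -> p@_0%MM = 0.
Proof.
have h0 g : (hvar g)@_0%MM = 0.
  by rewrite mcoeffX -mdeg_eq0 mdeg1.
case=> [a _|g A _ jA]; first exact: h0.
have [A0|[a aA]] := set_0Vmem A.
  have := built_building B; case=> /negP[].
  by move: (valP g) => /=; rewrite -jA A0 big_set0.
by rewrite (bigD1 a aA) /= rmorphM/= [X in X * _](_ : _ = 0) ?mul0r //
  mcoeffB !h0 subrr.
Qed.

Lemma wond_ideal_closed : idealr_closed wond_ideal.
Proof.
split=> [||a u v]; rewrite -?topredE /=.
- exact/asboolP/ideal_gen0.
- apply/asboolP => -[s Ss] /(congr1 (mcoeff 0%MM)).
  rewrite mcoeff1 eqxx raddf_sum big_seq big1 ?oner_eq0 //= => c cs.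
  by rewrite rmorphM/= [X in _ * X](wond_relation_coef0 (Ss c cs)) mulr0.
- by move=> /asboolP u_I /asboolP v_I; apply/asboolP/ideal_gen_lin.
Qed.

HB.instance Definition _ :=
  isIdealr.Build {mpoly int[nbidx]} wond_ideal wond_ideal_closed.

Definition wond_idealr : idealr {mpoly int[nbidx]} :=
  [the idealr {mpoly int[nbidx]} of wond_ideal].

Definition FY : comNzRingType := {ideal_quot wond_idealr}.

Definition FY_pi (p : {mpoly int[nbidx]}) : FY :=
  (\pi_{ideal_quot wond_idealr} p)%qT.

Lemma FY_pi_eq0 p : FY_pi p = 0 <-> ideal_gen wond_relation p.
Proof.
rewrite -[0 : FY](rmorph0 (\pi_{ideal_quot wond_idealr})%qT).
by split=> [/eqP|h]; [|apply/eqP]; rewrite -Quotient.idealrBE subr0;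
  [move=> /asboolP|apply/asboolP].
Qed.

Definition FY_weight (k : nat) (u : FY) : Prop :=
  exists2 p : {mpoly int[nbidx]}, p \is k.-homog & u = FY_pi p.

End FeichtnerYuzvinsky.

Section GroebnerBasis.
Variable n : nat.
Implicit Types (le : rel 'X_{1..n}) (p : {mpoly int[n]}).
Implicit Types (J : {mpoly int[n]} -> Prop).

Definition monomial_order le : Prop :=
  [/\ reflexive le, antisymmetric le, transitive le & total le] /\
  (forall m, le 0%MM m) /\
  (forall m1 m2 m, le m1 m2 -> le (m1 + m)%MM (m2 + m)%MM).

Definition lead_monom le p : 'X_{1..n} :=
  \big[(fun m1 m2 => if le m1 m2 then m2 else m1)/0%MM]_(m <- msupp p) m.

Definition lead_coeff le p : int := p@_(lead_monom le p).

Definition lead_term le p : {mpoly int[n]} :=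
  lead_coeff le p *: 'X_[lead_monom le p].

Definition lead_terms le J (t : {mpoly int[n]}) : Prop :=
  exists p, [/\ J p, p != 0 & t = lead_term le p].

Definition groebner_basis le J (s : seq {mpoly int[n]}) : Prop :=
  [/\ forall p, p \in s -> J p,
      forall p, p \in s -> lead_coeff le p = 1 \/ lead_coeff le p = -1
    & forall p, ideal_gen (lead_terms le J) p <->
                ideal_gen (lead_terms le (fun q => q \in s)) p].

Definition homogeneous_ideal J : Prop :=
  forall p k, J p -> J (pihomog mdeg k p).

End GroebnerBasis.

(* A (with homogeneous components given by wt) is the quotient of a polynomial
   ring by the kernel of a surjective ring morphism, which is graded since the
   generators have weight 1. *)
Definition admits_quadratic_groebner_basis
    (A : comNzRingType) (wt : nat -> A -> Prop) : Prop :=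
  exists (n : nat) (phi : {rmorphism {mpoly int[n]} -> A}),
    [/\ forall u, exists p, phi p = u,
        forall i : 'I_n, wt 1%N (phi 'X_i),
        homogeneous_ideal (fun p => phi p = 0)
      & exists (le : rel 'X_{1..n}) (s : seq {mpoly int[n]}),
          [/\ monomial_order le,
              groebner_basis le (fun p => phi p = 0) s
            & forall p, p \in s -> p \is 2.-homog]].

(* Main.v *)
Require Import Defs.
From mathcomp Require Import all_boot all_order all_algebra.
From mathcomp Require Import boolp mpoly zify.

(** Let [c 0 < ... < c n] be the flag of modular elements given by supersolvability.
    The level of [x] is the least [i] with [x <= c i], and [trunc x] is the meet of
    [x] with the element of the flag just below its level. By modularity [trunc x]
    has rank one less than [x], and it is again in the building set if [x] is in it
    and is not an atom. The variables [h_G], for [G] not an atom, are ordered by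
    decreasing level and, inside a level, by increasing rank; the monomial order is
    the degree lexicographic one.

    Quadratic relations. If [F] and [F'] are incomparable and [G := F `|` F'] is in
    the building set, then [(h_G - h_F) * (h_G - h_F') = 0]. Two such relations with
    the same [F] and the same [G] differ by [(h_G - h_F) * (h_F' - h_F'')]. These are
    products of linear forms, so their leading monomials are visible. They include
    every product of two variables of the same level ([reducible_same_level]) and
    every product [h_K * h_F], with [F] of lower level than [K], that is not
    [compatible] ([reducible_incompatible]).

    Linear forms. A chain [s] from bottom to top defines a stratum of the wonderful
    compactification for the maximal building set, hence a linear form
    [chain_degree s] on [FY]: pull back, restrict to the stratum, take the degree. On a monomial in the [h_G] its value is 0 or 1, and
    it is 1 when each step of the chain satisfies a marriage condition of Hall-Rado
    type, so that it can be defined by this condition. It vanishes on the ideal by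
    an exchange property ([dragon_exchange]): in a relation attached to an antichain
    with join [G], one element can be replaced by [G] without affecting the
    condition, and the terms cancel in pairs.

    Conclusion. Let [m] be a monomial divisible by none of the quadratic leading
    monomials above. It is squarefree, its support has at most one element in each
    level, and these elements are pairwise compatible. By induction on the level one builds a chain
    [s] that detects [m], and where each element of [m] is the largest one of its
    level in its step ([chain_through], based on [transverse_join], and through it
    on the fact that nestedness is a pairwise condition, [nested_join_notin]).
    Counting ranks level by level, [s] detects no monomial smaller than [m]
    ([detects_leading]). So if [m] were the leading monomial of an element of the
    ideal, [chain_degree s] would map this element to its leading coefficient, which
    would vanish. Every leading monomial of the ideal is therefore divisible by a
    quadratic one ([lead_divisible]), whose coefficient is 1. *)

Set Implicit Arguments.
Unset Strict Implicit.
Unset Printing Implicit Defensive.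

Import Order.TTheory GRing.Theory.

Local Open Scope order_scope.

(** * Rank in a geometric lattice *)

Section Rank.
Context {d : Order.disp_t} {L : finTBLatticeType d} (gL : geometric L).
Implicit Types (x y z a : L).

Lemma rank_lt x y : x < y -> (rank x < rank y)%N.
Proof.
move=> xy.
have ne : (0 < #|[pred C | is_chain_between \bot x C]|)%N.
  apply/card_gt0P; exists set0; rewrite inE; apply/andP.
  by split; apply/forallP => a; rewrite inE.
have [C] := eq_bigmax_cond (fun C : {set L} => #|C|.-1) ne.
rewrite inE => /andP[/forall_inP Cb /forall_inP Cc].
rewrite {1}/rank => ->.
have yC : y \notin x |: C.
  rewrite !inE negb_or gt_eqF //=; apply/negP => /Cb.
  by case/andP => _; rewrite lt_geF.
have bigchain : is_chain_between \bot y (y |: (x |: C)).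
  have below a : a \in y |: (x |: C) -> a <= y.
    rewrite !inE => /or3P[/eqP->//|/eqP->|/Cb]; first exact: ltW.
    by move=> /andP[_ ax]; exact: le_trans ax (ltW xy).
  apply/andP; split; apply/forall_inP => a aC; first by rewrite le0x below.
  apply/forall_inP => b bC; move: aC bC (below a aC) (below b bC).
  rewrite [a \in _]inE => /orP[/set1P-> _ _ /ge_comparable //|aC].
  rewrite inE => /orP[/set1P-> /le_comparable //|bC _ _].
  move: aC bC; rewrite !inE => /orP[/eqP->|aC] /orP[/eqP->|bC].
  - exact: comparablexx.
  - by case/andP: (Cb b bC) => _; exact: ge_comparable.
  - by case/andP: (Cb a aC) => _; exact: le_comparable.
  - by have /forall_inP := Cc a aC; exact.
rewrite /rank; apply: (@leq_trans #|y |: (x |: C)|.-1); last first.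
  exact: (bigop.leq_bigmax_cond (y |: (x |: C)) bigchain).
rewrite cardsU1 yC /=.
have := subset_leq_card (subsetUr [set x] C).
have : (0 < #|x |: C|)%N by apply/card_gt0P; exists x; rewrite setU11.
by move: #|C| #|_ |: C| => p q; lia.
Qed.

Lemma rank_le x y : x <= y -> (rank x <= rank y)%N.
Proof. by rewrite le_eqVlt => /orP[/eqP->//|/rank_lt/ltnW]. Qed.

Lemma rank_eq x y : x <= y -> (rank y <= rank x)%N -> x = y.
Proof. by rewrite le_eqVlt => /orP[/eqP//|/rank_lt]; rewrite ltnNge => /negP. Qed.

Lemma rank0 : rank (\bot : L) = 0.
Proof.
apply/eqP; rewrite -leqn0; apply/bigmax_leqP => C /andP[/forall_inP Cb _].
have : (#|C| <= #|[set \bot : L]|)%N; last by rewrite cards1; lia.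
by apply/subset_leq_card/subsetP => a /Cb; rewrite inE => /andP[_]; rewrite lex0.
Qed.

Lemma rank_gt0 x : (0 < rank x)%N = (x != \bot).
Proof.
apply/idP/idP => [|x0]; first by apply: contraTneq => ->; rewrite rank0.
by rewrite -rank0 rank_lt // lt0x.
Qed.

Lemma atom_gt0 a : is_atom a -> a != \bot.
Proof. by rewrite -rank_gt0 => /eqP->. Qed.

Lemma rank_meet_join x y :
  (rank (x `&` y) + rank (x `|` y) <= rank x + rank y)%N.
Proof. by case: gL => _ + _; exact. Qed.

Lemma atom_separates x y : ~~ (x <= y) ->
  exists a, [/\ is_atom a, a <= x & ~~ (a <= y)].
Proof.
case: gL => _ _ /(_ x) [A Aat ->] /negP xy.
have [/'exists_andP[a [aA ay]]|/existsPn nA] :=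
  boolP [exists a, (a \in A) && ~~ (a <= y)].
  by exists a; split=> //; [exact: Aat | exact: joins_sup].
case: xy; apply/joinsP => a aA; move: (nA a); rewrite aA /=.
by rewrite negbK.
Qed.

Lemma atom_below x : x != \bot -> exists2 a, is_atom a & a <= x.
Proof. by rewrite -lex0 => /atom_separates[a [? ? _]]; exists a. Qed.

Lemma rank_join_atom x a : is_atom a -> (rank (x `|` a) <= (rank x).+1)%N.
Proof. by move=> /eqP ra; have := rank_meet_join x a; rewrite ra; lia. Qed.

Lemma rank_join_atomN x a : is_atom a -> ~~ (a <= x) ->
  rank (x `|` a) = (rank x).+1.
Proof.
move=> aat ax; apply/eqP; rewrite eqn_leq rank_join_atom //= rank_lt //.
by rewrite lt_neqAle leUl andbT eq_sym eq_joinl.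
Qed.

Lemma atom_step x y : x < y ->
  exists a, [/\ is_atom a, a <= y, ~~ (a <= x) & rank (x `|` a) = (rank x).+1].
Proof.
move=> xy; have [] := @atom_separates y x; first by rewrite lt_geF.
by move=> a [aa ay ax]; exists a; rewrite rank_join_atomN.
Qed.

(** A rank missed by the chain could be added to it, by joining an atom to the
    element just below the gap. *)
Lemma maximal_chain_ranks (C : {set L}) r :
  is_maximal_chain \bot \top C -> (r <= rank (\top : L))%N ->
  exists2 x, x \in C & rank x = r.
Proof.
move=> /maxsetP[/andP[_ /forall_inP Cc] Cmax] rt.
have comp a b : a \in C -> b \in C -> a >=< b.
  by move=> /Cc/forall_inP; exact.
have inC x : (forall c, c \in C -> x >=< c) -> x \in C.
  move=> xC; rewrite -(Cmax (x |: C)) ?subsetUr ?setU11 //.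
  apply/andP; split; apply/forall_inP => a aC; first by rewrite le0x lex1.
  apply/forall_inP => b bC; move: aC bC.
  rewrite !inE => /orP[/eqP->|aC] /orP[/eqP->|bC];
    [exact: comparablexx|exact: xC|rewrite comparable_sym; exact: xC|exact: comp].
have botC : \bot \in C by apply: inC => c _; exact/le_comparable/le0x.
have topC : \top \in C by apply: inC => c _; exact/ge_comparable/lex1.
pose P := [pred x in C | (rank x <= r)%N].
have P0 : P \bot by rewrite /= botC rank0.
have [x /andP[xC xr] xmax] := arg_maxnP rank P0.
have [->|x_r] := eqVneq r (rank x); first by exists x.
have {x_r xr} xr : (rank x < r)%N by rewrite ltn_neqAle eq_sym x_r xr.
pose Q := [pred y in C | (r < rank y)%N || (rank y == r)].
have Qtop : Q \top by rewrite /= topC; move: rt; rewrite leq_eqVlt eq_sym orbC.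
have [y /andP[yC yr] ymin] := arg_minnP rank Qtop.
have ry : (r <= rank y)%N by move: yr; rewrite orbC eq_sym -leq_eqVlt.
have [ryE|ryE] := eqVneq (rank y) r; first by exists y.
have {}ry : (r < rank y)%N by rewrite ltn_neqAle eq_sym ryE ry.
have xy : x < y.
  case/orP: (comp _ _ xC yC); last by
    move=> /rank_le; rewrite leqNgt (ltn_trans xr).
  by rewrite le_eqVlt => /orP[/eqP xyE|//]; move: (ltn_trans xr ry); rewrite xyE ltnn.
have [a [aat ay ax xa]] := atom_step xy.
have /xmax : P (x `|` a); last by rewrite /= xa ltnn.
rewrite /= xa xr andbT; apply: inC => c cC; case/orP: (comp _ _ xC cC) => [xc|].
  case/orP: (comp _ _ yC cC) => [yc|].
    by apply: le_comparable; rewrite leUx xc (le_trans ay).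
  rewrite le_eqVlt => /orP[/eqP->|cy]; first by apply: le_comparable; rewrite leUx ay ltW.
  apply: ge_comparable; suff -> : c = x by rewrite leUl.
  apply/eqP; rewrite eq_sym; apply: contraT => xc'.
  have {xc xc'} xc : x < c by rewrite lt_neqAle xc' xc.
  have [/(conj cC)/andP/xmax|rc] := leqP (rank c) r; first by
    rewrite /= leqNgt rank_lt.
  have /ymin : Q c by rewrite /= cC rc.
  by rewrite /= leqNgt rank_lt.
by move=> cx; apply: ge_comparable; rewrite (le_trans cx) ?leUl.
Qed.

End Rank.

(** * Factors of a building set *)

Section Building.
Context {d : Order.disp_t} {L : finTBLatticeType d} (gL : geometric L).
Context (G : {set L}) (bG : building_set G).
Implicit Types (x y z a b : L).

Lemma bot_notin : \bot \notin G. Proof. by case: bG. Qed.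

Lemma building_neq0 b : b \in G -> b != \bot.
Proof. by apply: contraTneq => ->; exact: bot_notin. Qed.

Lemma max_belowP x g :
  reflect [/\ g \in G, g <= x & forall h, h \in G -> h <= x -> g <= h -> h = g]
    (g \in max_below G x).
Proof.
rewrite inE; apply: (iffP and3P) => -[gG gx gm]; split=> //.
  by move=> h hG hx gh; have /forall_inP/(_ h hG) := gm; rewrite hx gh => /eqP.
by apply/forall_inP => h hG; apply/implyP => /andP[hx gh]; rewrite (gm h).
Qed.

Lemma factor_above x b : b \in G -> b <= x ->
  exists2 g, g \in max_below G x & b <= g.
Proof.
move=> bG' bx; pose P := [pred g in G | (b <= g) && (g <= x)].
have Pb : P b by rewrite /= bG' lexx bx.
have [g /and3P[gG bg gx] gmax] := arg_maxnP rank Pb.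
exists g => //; apply/max_belowP; split=> // h hG hx gh.
apply/esym/rank_eq => //; apply: gmax.
by rewrite /= hG hx (le_trans bg gh).
Qed.

(** The meet makes any function on the lattice into a family of the product. *)
Definition family x (f : L -> L) : interval_product G x :=
  [ffun g => exist (fun y => y <= val g) (f (val g) `&` val g) (leIr _ _)].

Lemma join_map_family x f :
  join_map (family x f) = \join_(g in max_below G x) (f g `&` g).
Proof.
apply/le_anti/andP; split.
  apply/joinsP => g _; rewrite ffunE /=.
  by apply: (@joins_min _ _ _ (val g)); [exact: valP | exact: lexx].
apply/joinsP => g gx.
apply: (le_trans _ (joins_sup (j := exist _ g gx) _ _)) => //.
by rewrite ffunE.
Qed.

Lemma factor_embedding x f f' :
  \join_(g in max_below G x) (f g `&` g) <=
    \join_(g in max_below G x) (f' g `&` g) ->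
  forall g, g \in max_below G x -> f g `&` g <= f' g.
Proof.
rewrite -!join_map_family => le_ff' g gx.
case: bG => _ /(_ x) [/(_ (family x f) (family x f')) [/(_ le_ff') + _] _].
by move=> /(_ (exist _ g gx)); rewrite !ffunE /= lexI => /andP[].
Qed.

Lemma factor_decomposition x y : y <= x ->
  y = \join_(g in max_below G x) (y `&` g).
Proof.
case: bG => _ /(_ x)[_ /(_ y)[+ _]] => /[apply] -[f <-].
apply/le_anti/andP; split; last by apply/joinsP => g gx; exact: leIl.
apply/joinsP => g _.
apply: le_trans (joins_sup (j := val g) _ (valP g)).
rewrite lexI (valP (f g)) andbT.
exact: (joins_min (j := g) _ (lexx _)).
Qed.

Lemma join_factors x : \join_(g in max_below G x) g = x.
Proof.
rewrite [RHS](factor_decomposition (lexx x)).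
by apply: eq_bigr => g /max_belowP[_ gx _]; rewrite meet_r.
Qed.

Lemma atom_in_building a : is_atom a -> a \in G.
Proof.
move=> aat; have [g ga|no] := pickP (mem (max_below G a)); last first.
  by have := atom_gt0 aat; rewrite -(join_factors a) big_pred0 ?eqxx.
have /max_belowP[gG ga' _] := ga.
rewrite (_ : a = g) //; apply/esym/rank_eq => //.
by rewrite (eqP aat) rank_gt0 // building_neq0.
Qed.

(** This holds because every element is the join of its factors. *)
Lemma le_building x y : (forall b, b \in G -> b <= x -> b <= y) -> x <= y.
Proof.
by move=> xy; rewrite -(join_factors x); apply/joinsP => g /max_belowP[? ? _]; exact: xy.
Qed.

(** Each [t] lies below one factor, so replacing every factor by the join of the
    members of [T] below it does not change the total join; components being
    unique, no factor changes. *)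
Lemma factor_of_join (T : {set L}) g : T \subset G ->
  g \in max_below G (\join_(t in T) t) -> g = \join_(t in T | t <= g) t.
Proof.
move=> /subsetP TG; set x := \join_(t in T) t => gx.
apply/le_anti/andP; split; last by apply/joinsP => t /andP[].
pose f h := \join_(t in T | t <= h) t.
have fle h : f h `&` h = f h by apply/meet_l/joinsP => t /andP[].
have := @factor_embedding x id f _ g gx; rewrite meetxx; apply.
rewrite [in leRHS](eq_bigr f) => [|h _]; last exact: fle.
rewrite [in leLHS](eq_bigr id) ?join_factors => [|h _]; last exact: meetxx.
apply/joinsP => t tT.
have [h hx th] := factor_above (TG t tT) (joins_min tT (lexx _)).
apply: (joins_min hx).
by apply: (joins_min _ (lexx _)); rewrite tT.
Qed.

(** In two distinct factors of [x `|` y], the meet would give two families with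
    the same join and disjoint supports. *)
Lemma join_in_building x y : x \in G -> y \in G -> x `&` y != \bot ->
  x `|` y \in G.
Proof.
move=> xG yG; have [g gxy xg] := factor_above xG (leUl x y).
have [h hxy yh] := factor_above yG (leUr y x).
have /max_belowP[gG gle _] := gxy.
have [hg|hg] := eqVneq h g.
  suff -> : x `|` y = g by [].
  by apply/le_anti; rewrite gle leUx xg -hg yh.
case/negP; rewrite -lex0; set e := x `&` y.
have eg : e <= g by rewrite (le_trans _ xg) ?leIl.
have eh : e <= h by rewrite (le_trans _ yh) ?leIr.
pose f k := if k == g then e else \bot; pose f' k := if k == h then e else \bot.
have := @factor_embedding (x `|` y) f f' _ g gxy.
rewrite /f /f' eqxx eq_sym (negbTE hg) (meet_l eg); apply.
apply/joinsP => k _; case: eqVneq => [->|_]; last by rewrite meet0x le0x.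
rewrite (meet_l eg).
by apply: (joins_min hxy); rewrite eqxx meet_l.
Qed.

(** A factor other than [k] is determined by its component in [k `|` w], to which
    only [w] contributes. *)
Lemma below_factor_join k w b : k \in max_below G (k `|` w) ->
  b \in G -> b <= k `|` w -> b <= k \/ b <= w.
Proof.
move=> kk bG' bkw; have [g gx bg] := factor_above bG' bkw.
have [<-|gk] := eqVneq g k; first by left.
right; apply: le_trans bg _.
pose f' h := if h == k then k else w `&` h.
have := @factor_embedding (k `|` w) id f' _ g gx.
rewrite meetxx /f' (negbTE gk) => wg; apply: le_trans (wg _) (leIl _ _).
rewrite [in leLHS](eq_bigr id) ?join_factors => [|h _]; last exact: meetxx.
rewrite leUx; apply/andP; split.
  by apply: (joins_min kk); rewrite eqxx meetxx.
rewrite {1}(factor_decomposition (leUr w k)); apply/joinsP => h hx.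
apply: (joins_min hx); case: eqVneq => [->|_]; first by rewrite meetxx leIr.
by rewrite -meetA meetxx.
Qed.

Lemma below_nested_join x y b : x \in G -> y \in G -> x `|` y \notin G ->
  b \in G -> b <= x `|` y -> b <= x \/ b <= y.
Proof.
move=> xG yG xyG bG' bxy; apply: (below_factor_join _ bG' bxy).
apply/max_belowP; split=> [||h hG hxy xh]; rewrite ?leUl //.
have [g gxy hg] := factor_above hG hxy.
have /max_belowP[gG gle _] := gxy.
have [h' h'xy yh'] := factor_above yG (leUr y x).
have [h'g|h'g] := eqVneq h' g.
  case/negP: xyG; suff -> : x `|` y = g by [].
  by apply/le_anti; rewrite gle leUx (le_trans xh hg) -h'g yh'.
pose T := [set x; y].
have TG : T \subset G by apply/subsetP => t; rewrite !inE => /orP[]/eqP->.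
have jT : \join_(t in T) t = x `|` y.
  apply/le_anti/andP; split; last by rewrite leUx !joins_sup // !inE eqxx ?orbT.
  by apply/joinsP => t; rewrite !inE => /orP[]/eqP->; rewrite ?leUl ?leUr.
have := factor_of_join (g := g) TG; rewrite jT => /(_ gxy) gE.
apply/le_anti; rewrite xh andbT (le_trans hg) // gE.
apply/joinsP => t; rewrite !inE => /andP[/orP[]/eqP-> // yg].
case/negP: xyG; suff -> : x `|` y = g by [].
by apply/le_anti; rewrite gle leUx (le_trans xh hg) yg.
Qed.

End Building.

(** * The modular flag *)

(** The flag is indexed by all naturals and stationary from [n] on, so that its
    elements can be handled without bounds on the index. *)
Record modular_flag d (L : finTBLatticeType d) (G : {set L}) (c : nat -> L)
    (n : nat) : Prop := ModularFlag {
  flag0 : c 0 = \bot;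
  flagT : c n = \top;
  flagS : forall i, c i <= c i.+1;
  flag_cover : forall i a, a <= c i.+1 -> ~~ (a <= c i) -> a `|` c i = c i.+1;
  flag_modular : forall i, modular_element (c i);
  flag_meet : forall i g, g \in G -> c i `&` g \in G \/ c i `&` g = \bot
}.

Section Flag.
Context {d : Order.disp_t} {L : finTBLatticeType d} (gL : geometric L).
Context (G : {set L}) (bG : building_set G).
Context (c : nat -> L) (n : nat) (fc : modular_flag G c n).
Implicit Types (x y z a b w : L) (i j l : nat) (T : {set L}).

Lemma flag_le i j : (i <= j)%N -> c i <= c j.
Proof.
move=> /subnK <-; elim: (j - i)%N => [//|k IH].
by rewrite addSn (le_trans IH) ?(flagS fc).
Qed.

Lemma join_meet_flag i x y : x <= c i -> (x `|` y) `&` c i = x `|` (y `&` c i).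
Proof. by move=> xi; case: (flag_modular fc i y) => _ ->. Qed.

(** The levels entered by [x] are the labels of the chain that the flag cuts out
    in [[bot, x]]; there are [rank x] of them. *)
Definition enters i x : bool := ~~ (x `&` c i.+1 <= c i).

Lemma enters_le i x y : x <= y -> enters i x -> enters i y.
Proof. by move=> xy; apply: contra; apply: le_trans; rewrite leI2. Qed.

(** By modularity, an atom of [x] outside [c i] joins with [x `&` c i] to [x]. *)
Lemma rank_coatom i x : x <= c i.+1 -> ~~ (x <= c i) ->
  rank x = (rank (x `&` c i)).+1.
Proof.
move=> xi xni; have [a [aat ax ani]] := atom_separates gL xni.
rewrite -(rank_join_atomN gL aat); last by apply: contra ani => /le_trans; apply; rewrite leIr.
congr rank; case: (flag_modular fc i x) => /(_ a ax) + _.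
rewrite (flag_cover fc (le_trans ax xi) ani) (meet_r xi) => aE.
by rewrite joinC (meetC x) aE.
Qed.

Lemma rank_enters i x : rank (x `&` c i.+1) = (rank (x `&` c i) + enters i x)%N.
Proof.
have ii : x `&` c i.+1 `&` c i = x `&` c i by rewrite -meetA (meet_r (flagS fc i)).
rewrite /enters; have [le|nle] := boolP (_ <= _); rewrite ?addn0 ?addn1.
  by rewrite -ii (meet_l le).
by rewrite (rank_coatom _ nle) ?leIr // ii.
Qed.

Fact lvl_subproof x : exists i, x <= c i.
Proof. by exists n; rewrite (flagT fc) lex1. Qed.

Definition lvl x := ex_minn (lvl_subproof x).

Lemma le_flag x i : (x <= c i) = (lvl x <= i)%N.
Proof.
rewrite /lvl; case: ex_minnP => j xj jmin; apply/idP/idP; first exact: jmin.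
by move=> /flag_le; exact: le_trans.
Qed.

Lemma lvl_le x : x <= c (lvl x). Proof. by rewrite le_flag. Qed.

Lemma lvl_mono x y : x <= y -> (lvl x <= lvl y)%N.
Proof. by move=> xy; rewrite -le_flag (le_trans xy) ?lvl_le. Qed.

Lemma lvl_len x : (lvl x <= n)%N.
Proof. by rewrite -le_flag (flagT fc) lex1. Qed.

Lemma lvl_gt0 x : (0 < lvl x)%N = (x != \bot).
Proof. by rewrite ltnNge -le_flag (flag0 fc) lex0. Qed.

Lemma lvl_eq x i : x <= c i.+1 -> ~~ (x <= c i) -> lvl x = i.+1.
Proof. by rewrite !le_flag -ltnNge => xi ix; apply/eqP; rewrite eqn_leq xi ix. Qed.

Definition pred_lvl x := (lvl x).-1.
Definition trunc x := x `&` c (pred_lvl x).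

Lemma lvlK x : x != \bot -> lvl x = (pred_lvl x).+1.
Proof. by rewrite -lvl_gt0 /pred_lvl => /prednK. Qed.

Lemma le_flagS x : x <= c (pred_lvl x).+1.
Proof. by rewrite le_flag /pred_lvl leqSpred. Qed.

Lemma not_le_flag x : x != \bot -> ~~ (x <= c (pred_lvl x)).
Proof. by rewrite le_flag => /lvlK->; rewrite ltnn. Qed.

Lemma entersP x y : x != \bot -> x <= y -> enters (pred_lvl x) y.
Proof.
move=> x0 xy; apply: (enters_le xy).
by rewrite /enters (meet_l (le_flagS x)) not_le_flag.
Qed.

Lemma trunc_le x : trunc x <= x. Proof. exact: leIl. Qed.

Lemma rank_trunc x : x != \bot -> rank x = (rank (trunc x)).+1.
Proof. by move=> x0; rewrite -rank_coatom ?le_flagS ?not_le_flag. Qed.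

Lemma trunc_in x : x \in G -> ~~ is_atom x -> trunc x \in G.
Proof.
move=> xG xna; rewrite /trunc meetC; case: (flag_meet fc (pred_lvl x) xG) => // x0.
case/negP: xna; rewrite /is_atom rank_trunc ?(building_neq0 bG) //.
by rewrite /trunc meetC x0 rank0.
Qed.

Lemma meet_flag_in x i : x \in G -> x `&` c i != \bot -> x `&` c i \in G.
Proof. by rewrite meetC => xG; case: (flag_meet fc i xG) => // ->; rewrite eqxx. Qed.

(** Two members of [G] of the same level contain atoms [h] and [k] of that level;
    the modular element just below cuts the line through [h] and [k] in a third
    point, so the line cannot split along the two members. *)
Lemma same_level_join x y : x \in G -> y \in G -> lvl x = lvl y ->
  x `|` y \in G.
Proof.
move=> xG yG xy; apply: contraT => xyG.
have x0 := building_neq0 bG xG; have y0 := building_neq0 bG yG.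
set i := pred_lvl x; have iE : pred_lvl y = i by rewrite /i /pred_lvl xy.
have [h [hat hx hi]] := atom_separates gL (not_le_flag x0).
have [k [kat ky ki]] := atom_separates gL (not_le_flag y0).
rewrite iE in ki.
have hi1 : h <= c i.+1 by rewrite (le_trans hx) ?le_flagS.
have ki1 : k <= c i.+1 by rewrite (le_trans ky) // -iE le_flagS.
have xy0 : x `&` y = \bot.
  by apply: contraTeq xyG => xy0; rewrite negbK join_in_building.
have line (p q : L) : p <= c i.+1 -> q <= c i.+1 -> ~~ (p <= c i) ->
    p `|` (c i `&` (p `|` q)) = p `|` q.
  move=> p1 q1 pi; case: (flag_modular fc i (p `|` q)) => /(_ p (leUl p q)) -> _.
  by rewrite (flag_cover fc p1 pi) meet_r // leUx p1.
pose e := c i `&` (h `|` k).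
have hk : ~~ (k <= h).
  apply/negP => kh; have : k <= x `&` y by rewrite lexI ky (le_trans kh).
  by rewrite xy0 lex0 (negbTE (atom_gt0 kat)).
have e0 : e != \bot.
  apply: contraNneq hk => e0; have := line h k hi1 ki1 hi.
  by rewrite -/e e0 joinx0 => ->; rewrite leUr.
have [b bat be] := atom_below gL e0.
have bG' := atom_in_building bG bat.
have bhk : b <= h `|` k := le_trans be (leIr _ _).
have bi : b <= c i := le_trans be (leIl _ _).
(* Two distinct atoms of the line span it. *)
have span p : is_atom p -> p <= h `|` k -> ~~ (p <= c i) -> p `|` b = h `|` k.
  move=> pat phk pi; apply: rank_eq; first by rewrite leUx phk bhk.
  rewrite (rank_join_atomN gL kat hk) (eqP hat) (rank_join_atomN gL bat) ?(eqP pat) //.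
  apply: contra pi => bp; suff <- : b = p by [].
  by apply: rank_eq => //; rewrite (eqP bat) (eqP pat).
have bxy : b <= x `|` y by rewrite (le_trans bhk) ?leU2.
have [bx|by_] := below_nested_join bG xG yG xyG bG' bxy.
  have : k <= x `&` y.
    by rewrite lexI ky andbT (le_trans (leUr k h)) // -(span h) ?leUl // leUx hx.
  by rewrite xy0 lex0 (negbTE (atom_gt0 kat)).
have : h <= x `&` y.
  by rewrite lexI hx (le_trans (leUl h k)) // -(span k) ?leUr // leUx ky.
by rewrite xy0 lex0 (negbTE (atom_gt0 hat)).
Qed.

Definition pairwise_nested T : Prop :=
  {in T &, forall s t, s != t -> s `|` t \notin G}.

(** Nestedness is a pairwise condition. A join of pairwise nested members lying
    in [G] could be cut down by the flag: the member of highest level is unique,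
    and replacing it by its truncation gives a smaller counterexample. *)
Lemma nested_join_notin T : T \subset G -> pairwise_nested T -> (1 < #|T|)%N ->
  \join_(t in T) t \notin G.
Proof.
have [m] := ubnP (rank (\join_(t in T) t)); elim: m T => // m IH T.
rewrite ltnS => rT /subsetP TG nT cT; apply/negP => jG.
have [t0 t0T tmax] : exists2 t0, t0 \in T & forall t, t \in T -> (lvl t <= lvl t0)%N.
  have [t tT] : exists t, t \in T by apply/card_gt0P; exact: ltnW.
  by have [t0 t0T tmax] := arg_maxnP (P := mem T) lvl tT; exists t0.
have [t1 t1T] : exists t, t \in T :\ t0.
  by apply/card_gt0P; move: cT; rewrite (cardsD1 t0 T) t0T.
have t0G := TG _ t0T; have t00 := building_neq0 bG t0G.
have [t10 {}t1T] := setD1P t1T; have t1G := TG _ t1T.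
set y := \join_(t in T :\ t0) t; set i := pred_lvl t0.
have yi : y <= c i.
  apply/joinsP => t /setD1P[tt0 tT]; rewrite le_flag /i.
  have := tmax t tT; rewrite (lvlK t00) leq_eqVlt => /orP[/eqP|//].
  rewrite -(lvlK t00) => /(same_level_join (TG _ tT) t0G).
  by rewrite (negbTE (nT _ _ tT t0T tt0)).
have jE : \join_(t in T) t = y `|` t0.
  apply/le_anti/andP; split; last first.
    rewrite leUx; apply/andP; split; last exact: joins_sup.
    by apply/joinsP => t /setD1P[_ tT]; exact: joins_sup.
  apply/joinsP => t tT; have [->|tt0] := eqVneq t t0; first exact: leUr.
  by apply: (le_trans _ (leUl _ _)); apply: joins_sup; rewrite !inE tt0.
have y1 : t1 <= y by apply: joins_sup; rewrite !inE t10.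
have yt0G : y `|` trunc t0 \in G.
  rewrite -(join_meet_flag _ yi) -jE meet_flag_in //.
  apply: contraNneq (building_neq0 bG t1G) => j0.
  rewrite -lex0 -j0 lexI joins_sup //=; exact: le_trans yi.
have small z : z <= c i -> z <= \join_(t in T) t -> (rank z < m)%N.
  move=> zi zj; apply: leq_trans rT; apply: rank_lt.
  rewrite lt_neqAle zj andbT; apply: contraNneq (not_le_flag t00) => zE.
  by rewrite -/i (le_trans _ zi) // zE joins_sup.
have trunc_i : trunc t0 <= c i by exact: leIr.
have y_j : y <= \join_(t in T) t by rewrite jE leUl.
have [p0|p0] := eqVneq (trunc t0) \bot.
  have yG : y \in G by move: yt0G; rewrite p0 joinx0.
  have [T1|T1] := leqP #|T :\ t0| 1; last first.
    suff : y \notin G by rewrite yG.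
    apply: (IH (T :\ t0) (small _ yi y_j) _ _ T1).
      by apply/subsetP => t /setD1P[_ /TG].
    by move=> s t /setD1P[_ sT] /setD1P[_ tT]; exact: nT.
  have {}t1T' : t1 \in T :\ t0 by rewrite !inE t10.
  have /cards1P[u uE] : #|T :\ t0| == 1 by rewrite eqn_leq T1 (cardsD1 t1) t1T'.
  move: t1T'; rewrite uE => /set1P t1u.
  by move: jG; rewrite jE /y uE big_set1 -t1u (negbTE (nT _ _ t1T t0T t10)).
have p0G : trunc t0 \in G := meet_flag_in t0G p0.
pose T' := trunc t0 |: T :\ t0.
have nested_p t : t \in T :\ t0 -> trunc t0 `|` t \notin G.
  move=> /setD1P[tt0 tT]; apply/negP => ptG.
  have /negP[] := nT _ _ t0T tT (contra_neq (fun e => esym e) tt0).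
  have <- : t0 `|` (trunc t0 `|` t) = t0 `|` t.
    by rewrite joinA (join_l (trunc_le t0)).
  apply: join_in_building => //; rewrite -lt0x.
  apply: lt_le_trans (_ : trunc t0 <= _); first by rewrite lt0x.
  by rewrite lexI trunc_le leUl.
have pT : trunc t0 \notin T :\ t0.
  by apply/negP => /nested_p; rewrite joinxx p0G.
have jT' : \join_(t in T') t = y `|` trunc t0.
  by rewrite /T' big_setU1 //= joinC.
have /negP[] : \join_(t in T') t \notin G; last by rewrite jT'.
apply: IH.
- by rewrite jT'; apply: small; rewrite leUx ?yi // y_j (le_trans (trunc_le t0)) ?joins_sup.
- apply/subsetP => t; rewrite !inE => /orP[/eqP-> //|/andP[_ /TG //]].
- move=> s t; rewrite [s \in _]inE [t \in _]inE => /orP[/set1P->|sT] /orP[/set1P->|tT].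
  + by rewrite eqxx.
  + by move=> _; exact: nested_p.
  + by move=> _; rewrite joinC; exact: nested_p.
  + by case/setD1P: sT => _ sT; case/setD1P: tT => _ tT; exact: nT.
by rewrite /T' cardsU1 pT; move: cT; rewrite (cardsD1 t0 T) t0T.
Qed.

Lemma below_nested T b : T \subset G -> pairwise_nested T -> b \in G ->
  b <= \join_(t in T) t -> exists2 t, t \in T & b <= t.
Proof.
move=> TG nT bG' bT; have [g gT bg] := factor_above bG' bT.
pose U := [set t in T | t <= g].
have gE : g = \join_(t in U) t.
  rewrite {1}(factor_of_join bG TG gT); apply: eq_bigl => t; by rewrite inE.
have gG : g \in G by case/max_belowP: gT.
have UT : U \subset T by apply/subsetP => t; rewrite inE => /andP[].
have : ~~ (1 < #|U|)%N.
  apply/negP => U1; have nU : pairwise_nested U.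
    by move=> s t sU tU; apply: nT; exact: (subsetP UT).
  by have := nested_join_notin (subset_trans UT TG) nU U1; rewrite -gE gG.
rewrite -leqNgt leq_eqVlt => /orP[/cards1P[t tE]|].
  exists t; first by apply: (subsetP UT); rewrite tE set11.
  by rewrite (le_trans bg) // gE tE big_set1.
rewrite ltnS leqn0 cards_eq0 => /eqP U0.
by move: gG; rewrite gE U0 big_set0 (negbTE (bot_notin bG)).
Qed.

(** * Transverse members *)

(** [x] survives in the interval above [w]: no level is lost, the truncation of
    [x] does not collapse into [w], and [x] is the largest member of its level
    below [x `|` w]. *)
Definition transverse x w : bool :=
  [&& ~~ enters (pred_lvl x) w, ~~ (trunc x <= w) &
      [forall k in G, (lvl k == lvl x) && (k <= x `|` w) ==> (k <= x)]].

Lemma transverseP x w :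
  reflect [/\ ~~ enters (pred_lvl x) w, ~~ (trunc x <= w) &
      forall k, k \in G -> lvl k = lvl x -> k <= x `|` w -> k <= x]
    (transverse x w).
Proof.
apply: (iffP and3P) => -[? ? xm]; split=> //.
  by move=> k kG kx kxw; have /forall_inP/(_ k kG) := xm; rewrite kx eqxx kxw.
by apply/forall_inP => k kG; apply/implyP => /andP[/eqP kx]; exact: xm.
Qed.

Lemma transverse_le x v w : v <= w -> transverse x w -> transverse x v.
Proof.
move=> vw /transverseP[e t m]; apply/transverseP; split.
- by apply: contra e; exact: enters_le.
- by apply: contra t => /le_trans; exact.
- by move=> k kG kx kv; apply: m => //; rewrite (le_trans kv) ?leU2.
Qed.

Lemma transverse_bot x : x \in G -> ~~ is_atom x -> transverse x \bot.
Proof.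
move=> xG xa; apply/transverseP; split.
- by rewrite /enters meet0x le0x.
- by rewrite lex0 (building_neq0 bG (trunc_in xG xa)).
- by move=> k _ _; rewrite joinx0.
Qed.

(** For [x] of lower level than [k], compatible pairs are those whose product is
    not the leading monomial of a quadratic relation. In the second case [k] and
    [x] belong to a common nested set. *)
Definition compatible k x : bool :=
  [|| x <= trunc k, x `|` trunc k \notin G | transverse x (trunc k)].

Lemma transverse_factor k w : k \in G -> w <= c (pred_lvl k) -> transverse k w ->
  k \in max_below G (k `|` w).
Proof.
move=> kG wk /transverseP[_ _ kmax]; have k0 := building_neq0 bG kG.
apply/max_belowP; split=> [||h hG hkw kh]; rewrite ?leUl //.
apply/le_anti; rewrite kh andbT; apply: kmax => //; apply/eqP.
rewrite eqn_leq (lvl_mono kh) andbT -le_flag (le_trans hkw) // leUx lvl_le.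
by rewrite (le_trans wk) // flag_le // leq_pred.
Qed.

(** Since [k] is a factor of [k `|` w], a member below [trunc k `|` w] is below one
    of the two, which reduces the first two conditions to the hypotheses on
    [trunc k] and on [w]. For the maximality of [x], cut with the flag at the level
    of [x]: what remains is the join of [x], of the trace of [trunc k], and of factors
    of [w]. The trace of [trunc k] is below [x] unless it is nested with [x], and
    then all these members are pairwise nested, so [below_nested] applies. *)
Lemma transverse_join k x w : k \in G -> x \in G -> ~~ is_atom k ->
  ~~ is_atom x -> (lvl x < lvl k)%N -> w <= c (pred_lvl k) ->
  transverse k w -> transverse x w -> compatible k x -> ~~ (x <= trunc k `|` w) ->
  transverse x (trunc k `|` w).
Proof.
move=> kG xG ka xa xk wk tkw txw cxk xz.
set a := trunc k; set z := a `|` w.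
have aG : a \in G := trunc_in kG ka.
have x0 := building_neq0 bG xG; have k0 := building_neq0 bG kG.
have xna : ~~ (x <= a) by apply: contra xz => /le_trans; apply; rewrite leUl.
set j := pred_lvl x; have xj : x <= c j.+1 := le_flagS x.
have zk : z <= c (pred_lvl k) by rewrite leUx wk leIr.
have az : a <= z := leUl a w; have wz : w <= z := leUr w a.
have split_z b : b \in G -> b <= z -> b <= a \/ b <= w.
  move=> bG' bz.
  have [||bk|bw] := below_factor_join bG (k := k) (w := w) _ bG'; [| |left|by right].
  - exact: transverse_factor.
  - by rewrite (le_trans bz) ?leU2 ?trunc_le.
  - by rewrite /a /trunc lexI bk (le_trans bz).
have /transverseP[txw_e txw_t txw_m] := txw.
(* A member meeting [a] pulls [a] into its join with [x]. *)
have join_a b : b \in G -> b <= a -> x `|` b \in G -> x `|` a \in G.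
  move=> bG' ba xbG; have -> : x `|` a = x `|` b `|` a by rewrite -joinA (join_r ba).
  apply: join_in_building => //; rewrite -lt0x.
  by apply: lt_le_trans (_ : b <= _); rewrite ?lt0x ?(building_neq0 bG) // lexI leUr.
have enters_z : ~~ enters j z.
  apply/negP => ez; have [b [bG' bz bj]] :
      exists b, [/\ b \in G, b <= z `&` c j.+1 & ~~ (b <= c j)].
    apply: contrapT => no; case/negP: ez; apply: (le_building bG) => b bG' bz.
    by apply: contraT => bj; case: no; exists b.
  move: bz; rewrite lexI => /andP[bz bj1]; have b0 := building_neq0 bG bG'.
  have bx : lvl b = lvl x by rewrite (lvl_eq bj1 bj) -lvlK.
  have pb : pred_lvl b = j by rewrite /j /pred_lvl bx.
  case: (split_z b bG' bz) => [ba|/(entersP b0)]; last first.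
    by rewrite pb; exact/negP.
  have xbG : x `|` b \in G by exact: same_level_join.
  case/or3P: cxk => [|/negP[]|/transverseP[]]; first by rewrite (negbTE xna).
    exact: join_a xbG.
  by rewrite -/j -pb -/a (entersP b0 ba).
apply/transverseP; split=> //.
  apply/negP => /(split_z _ (trunc_in xG xa))[ta|tw]; last by rewrite tw in txw_t.
  case/or3P: cxk => [|/negP[]|/transverseP[_]]; first by rewrite (negbTE xna).
    apply: join_a ta _; first exact: trunc_in.
    by rewrite join_l ?trunc_le.
  by rewrite ta.
move=> h hG hx hxz; have h0 := building_neq0 bG hG.
have pred_h : pred_lvl h = j by rewrite /j /pred_lvl hx.
have hz : ~~ (h <= z).
  by apply: contra enters_z => hz; rewrite -pred_h entersP.
set a' := a `&` c j.+1; set w' := w `&` c j.+1.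
have zaw : z `&` c j.+1 <= a' `|` w'.
  apply: (le_building bG) => b bG'; rewrite lexI => /andP[/(split_z _ bG')[bb|bb] bj].
    by rewrite (le_trans _ (leUl _ _)) // lexI bb.
  by rewrite (le_trans _ (leUr _ _)) // lexI bb.
have {hxz} hxaw : h <= x `|` (a' `|` w').
  apply: le_trans (leU2 (lexx x) zaw); rewrite -(join_meet_flag _ xj) lexI hxz.
  by rewrite -pred_h le_flagS.
have a'a : a' <= a by exact: leIl.
have w'w : w' <= w by exact: leIl.
have a'j : a' <= c j.+1 by exact: leIr.
have w'j : w' <= c j.+1 by exact: leIr.
have lvl_x y : x <= y -> y <= c j.+1 -> lvl y = lvl x.
  move=> xy yj; rewrite (lvl_eq yj) -?lvlK //.
  by apply: contra (not_le_flag x0) => /(le_trans xy).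
have by_w : h <= x `|` w' -> h <= x.
  by move=> hxw; apply: txw_m => //; rewrite (le_trans hxw) ?leU2.
have [xaG|xaG] := boolP (x `|` a \in G).
  have txa : transverse x a by move: cxk; rewrite /compatible -/a xaG (negbTE xna).
  have xa'x : x `|` a' <= x.
    case/transverseP: txa => _ _; apply; rewrite ?leU2 //; last first.
      by apply: lvl_x; rewrite ?leUl // leUx xj.
    rewrite -(join_meet_flag _ xj) meet_flag_in // (join_meet_flag _ xj).
    by rewrite -lt0x (lt_le_trans _ (leUl x a')) // lt0x.
  by apply: by_w; rewrite (le_trans hxaw) // joinA leU2.
have [a'w'|a'w'] := boolP (a' <= w').
  by apply: by_w; rewrite (le_trans hxaw) // (join_r a'w').
have a'0 : a' != \bot by apply: contraNneq a'w' => ->; exact: le0x.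
have a'G : a' \in G := meet_flag_in aG a'0.
pose W := [set t in max_below G w' | ~~ (t <= x) & ~~ (t <= a')].
have WP t : t \in W -> [/\ t \in max_below G w', t \in G, t <= w', ~~ (t <= x) & ~~ (t <= a')].
  by rewrite inE => /and3P[tw tx ta]; have /max_belowP[] := tw.
pose T := x |: (a' |: W).
have xa' : x `|` a' \notin G by apply: contra xaG; exact: join_a.
have xW t : t \in W -> x `|` t \notin G.
  case/WP=> tw tG tw' tx _; apply: contra tx => xtG.
  apply: le_trans (leUr t x) (txw_m _ xtG _ _).
    by apply: lvl_x; rewrite ?leUl // leUx xj (le_trans tw').
  by rewrite leU2 // (le_trans tw').
have aW t : t \in W -> a' `|` t \notin G.
  case/WP=> tw tG tw' _ ta; apply/negP => atG.
  case: (split_z _ atG); first by rewrite leU2 // (le_trans tw').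
    by rewrite leUx a'a => /= ta'; case/negP: ta; rewrite lexI ta' (le_trans tw').
  rewrite leUx => /andP[aw _]; case/negP: a'w'.
  by rewrite lexI aw.
have WW s t : s \in W -> t \in W -> s != t -> s `|` t \notin G.
  move=> /WP[sw sG sw' _ _] /WP[tw tG tw' _ _]; apply: contra => stG.
  have /max_belowP[_ _ smax] := sw; have /max_belowP[_ _ tmax] := tw.
  rewrite -[X in X == _](smax _ stG) ?leUl // ?leUx ?sw' //.
  by rewrite (tmax _ stG) ?leUr // leUx sw'.
have [t tT ht] : exists2 t, t \in T & h <= t.
  apply: below_nested hG _.
  - apply/subsetP => t; rewrite !inE => /or3P[/eqP->//|/eqP->//|].
    by case/andP=> /and3P[].
  - move=> s t; rewrite !in_setU1.
    move=> /or3P[/eqP->|/eqP->|sW] /or3P[/eqP->|/eqP->|tW]; rewrite ?eqxx // => st.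
    + exact: xW.
    + by rewrite joinC.
    + exact: aW.
    + by rewrite joinC xW.
    + by rewrite joinC aW.
    + exact: WW.
  - have leT t : t \in T -> t <= \join_(t in T) t.
      exact: (@joins_sup _ _ _ t (fun t => t \in T) (fun t => t)).
    apply: le_trans hxaw _; have xT : x <= \join_(t in T) t.
      by apply: leT; rewrite !inE eqxx.
    have aT : a' <= \join_(t in T) t.
      by apply: leT; rewrite !inE eqxx orbT.
    rewrite !leUx xT aT /= -(join_factors bG w'); apply/joinsP => t tw.
    have [tx|tx] := boolP (t <= x); first exact: le_trans xT.
    have [ta|ta] := boolP (t <= a'); first exact: le_trans aT.
    by apply: leT; rewrite !in_setU1 [t \in W]inE tw tx ta !orbT.
move: tT; rewrite !in_setU1 => /or3P[/eqP<-//|/eqP tE|/WP[_ _ tw' _ _]];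
  case/negP: hz; rewrite (le_trans ht) //.
  by rewrite tE (le_trans a'a).
by rewrite (le_trans tw') // (le_trans w'w).
Qed.

(** * Chains that see every element of a compatible set *)

Definition steps x (s : seq L) := zip (x :: s) s.

Lemma steps_cons x y s : steps x (y :: s) = (x, y) :: steps y s.
Proof. by []. Qed.

Lemma steps_cat x s1 s2 : steps x (s1 ++ s2) = steps x s1 ++ steps (last x s1) s2.
Proof. by elim: s1 x => [//|y s1 IH] x; rewrite cat_cons !steps_cons IH. Qed.

Lemma steps_map (f : L -> L) x s :
  steps (f x) (map f s) = [seq (f p.1, f p.2) | p <- steps x s].
Proof. by elim: s x => [//|y s IH] x; rewrite /= -IH. Qed.

Lemma path_le_last x s : path <=%O x s -> x <= last x s.
Proof. by elim: s x => //= y s IH x /andP[xy /IH]; exact: le_trans. Qed.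

Lemma path_mem_le x s y : path <=%O x s -> y \in s -> x <= y <= last x s.
Proof.
elim: s x => //= z s IH x /andP[xz zs]; rewrite inE => /orP[/eqP->|ys].
  by rewrite xz path_le_last.
by have /andP[zy ->] := IH _ zs ys; rewrite (le_trans xz).
Qed.

Lemma path_steps x s p : path <=%O x s -> p \in steps x s ->
  [/\ x <= p.1, p.1 <= p.2, p.2 <= last x s & p.2 \in s].
Proof.
elim: s x => //= y s IH x /andP[xy ys]; rewrite inE => /orP[/eqP->/=|ps].
  by rewrite path_le_last // mem_head lexx.
have [yp p12 pl ps2] := IH _ ys ps.
by rewrite (le_trans xy yp) p12 pl inE ps2 orbT.
Qed.

Lemma path_join h x s : path <=%O x s ->
  path <=%O (x `|` h) [seq v `|` h | v <- s].
Proof.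
by apply: (homo_path (f := fun v => v `|` h)) => u v uv; rewrite leU2.
Qed.

(** What a step [p.1 <= p.2] of the final chain must satisfy to detect [t]. *)
Definition survives t (p : L * L) : Prop :=
  [/\ t <= p.2, ~~ enters (pred_lvl t) p.1, ~~ (trunc t <= p.1) &
      forall k, k \in G -> lvl k = lvl t -> k <= p.2 -> k <= t].

(** All the levels entered during the step, with at most one exception, are levels
    of [T]; the stratum of a step has dimension one less than the number of levels
    entered. *)
Definition saturated T m (p : L * L) : Prop :=
  exists i0, forall i, (i < m)%N -> enters i p.2 -> ~~ enters i p.1 -> i != i0 ->
    exists2 t, t \in T & lvl t = i.+1.

(** Joining with [h], of level [m.+1], moves a chain of [[bot, c m]] that starts above
    the trace of [h] up to level [m.+1], without changing what happens at the
    lower levels. *)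
Section Lift.
Variables (m : nat) (h : L).
Hypotheses (hm1 : h <= c m.+1) (hm : ~~ (h <= c m)).

Lemma lift_meet v : h `&` c m <= v -> v <= c m -> (v `|` h) `&` c m = v.
Proof. by move=> hv vm; rewrite join_meet_flag // join_l. Qed.

Lemma lift_join u : h <= u -> u <= c m.+1 -> u `&` c m `|` h = u.
Proof.
move=> hu um; case: (flag_modular fc m u) => /(_ h hu) + _.
by rewrite (flag_cover fc hm1 hm) (meet_r um) joinC meetC.
Qed.

Lemma lift_le v t : h `&` c m <= v -> v <= c m -> t <= c m ->
  (t <= v `|` h) = (t <= v).
Proof.
move=> hv vm tm; apply/idP/idP => [tvh|/le_trans]; last by apply; exact: leUl.
by rewrite -(lift_meet hv vm) lexI tvh.
Qed.

Lemma lift_enters v i : h `&` c m <= v -> v <= c m -> (i < m)%N ->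
  enters i (v `|` h) = enters i v.
Proof.
move=> hv vm im; rewrite /enters -{2}(lift_meet hv vm).
by rewrite -meetA (meet_r (flag_le im)).
Qed.

Lemma survives_lift t x y (b : bool) : t \in G -> (lvl t <= m)%N ->
  h `&` c m <= y -> x <= y -> y <= c m -> (b -> h `&` c m <= x) ->
  survives t (x, y) -> survives t (if b then x `|` h else x, y `|` h).
Proof.
move=> tG tm hy xy ym hx [/= ty tx ttx tmax].
have xm := le_trans xy ym; have t_m : t <= c m by rewrite le_flag.
have t0 := building_neq0 bG tG.
split=> /=.
- by rewrite (le_trans ty) ?leUl.
- by case: b hx => [/(_ isT) hx|//]; rewrite lift_enters //; move: tm; rewrite (lvlK t0).
- case: b hx => [/(_ isT) hx|//].
  by rewrite lift_le // (le_trans (trunc_le t)).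
- by move=> k kG kt; rewrite lift_le // ?le_flag ?kt //; exact: tmax.
Qed.

End Lift.

(** Induction on the top level [m.+1], the given chain [s] being a constraint. Let
    [w] be the last element of [s] below [c m], and [y] the next one. If [k] in [T]
    has level [m.+1], then [k] lives in the step from [w] to [y]: cut [s] with
    [c m], insert [z := trunc k `|` w] after [w], solve the problem for the other
    elements, which [transverse_join] allows, and join with [k] the part of the
    solution from [z] on. Level [m.+1] is thus added to the step ending at [z]. If
    no element of [T] has level [m.+1], this level gets a step of its own, from
    [y `&` c m] to [y]. *)
Lemma chain_through m T s : T \subset G -> {in T, forall t, ~~ is_atom t} ->
  {in T &, injective lvl} ->
  {in T &, forall k x, (lvl x < lvl k)%N -> compatible k x} ->
  {in T, forall t, (lvl t <= m)%N} ->
  path <=%O \bot s -> last \bot s = c m ->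
  {in T, forall t, exists2 p, p \in steps \bot s & t <= p.2 /\ transverse t p.1} ->
  exists s', [/\ path <=%O \bot s', last \bot s' = c m, {subset s <= s'},
    {in T, forall t, exists2 p, p \in steps \bot s' & survives t p} &
    {in steps \bot s', forall p, saturated T m p}].
Proof.
elim: m T s => [|m IH] T s TG Tna Tinj Tco Tm sp sl sT.
  have T0 t : t \notin T.
    apply/negP => tT; have := Tm t tT; rewrite leqn0 -leqn0 leqNgt lvl_gt0.
    by rewrite (building_neq0 bG) ?(subsetP TG).
  exists s; split=> //; first by move=> t tT; have := T0 t; rewrite tT.
  by move=> p _; exists 0.
have TG' := subsetP TG.
pose f := fun x => x `&` c m.
have fpath x s2 : path <=%O x s2 -> path <=%O (f x) (map f s2).
  by move=> xs; rewrite path_map; apply: sub_path xs => u v uv; rewrite /= leI2.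
have [hasM|] := boolP (has (fun y => ~~ (y <= c m)) s); last first.
  (* The level m is void. *)
  rewrite -all_predC => /allP /= sM.
  have cm : c m.+1 = c m.
    apply/le_anti; rewrite (flagS fc) andbT -sl; have := mem_last \bot s.
    by rewrite inE => /orP[/eqP->|/sM]; rewrite ?le0x ?negbK.
  have Tm' : {in T, forall t, (lvl t <= m)%N}.
    by move=> t tT; rewrite -le_flag -cm le_flag Tm.
  rewrite cm in sl *; have [s' [sp' sl' ss' sur sat]] := IH T s TG Tna Tinj Tco Tm' sp sl sT.
  exists s'; split=> // p ps; have [i0 i0P] := sat p ps; exists i0 => i.
  rewrite ltnS leq_eqVlt => /orP[/eqP->|]; last exact: i0P.
  by rewrite /enters cm leIr.
have [y [s1 [s2 [sE ym s1m]]]] : 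
    exists y s1 s2, [/\ s = s1 ++ y :: s2, ~~ (y <= c m) &
      {in s1, forall x, x <= c m}].
  have [y s1 s2 ym s1m] := split_find hasM; exists y, s1, s2; rewrite cat_rcons; split=> //.
  by move=> x xs1; move: s1m => /hasPn/(_ x xs1); rewrite negbK.
subst s; set w := last \bot s1.
move: sp sl; rewrite cat_path last_cat /= -/w => /and3P[s1p wy ys2] sl.
have wm : w <= c m by rewrite /w; have := mem_last \bot s1;
  rewrite inE => /orP[/eqP->|/s1m //]; rewrite le0x.
have ws1 x : x \in s1 -> x <= w by move=> xs1; have /andP[] := path_mem_le s1p xs1.
have y_le : y <= c m.+1 by rewrite -sl path_le_last.
have s2_le u : u \in y :: s2 -> y <= u <= c m.+1.
  rewrite inE => /orP[/eqP->|us]; first by rewrite lexx.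
  by rewrite -sl; exact: path_mem_le.
have stepsE : steps \bot (s1 ++ y :: s2) = steps \bot s1 ++ (w, y) :: steps y s2.
  by rewrite steps_cat.
have fsteps p : p \in steps y s2 -> (f p.1, f p.2) \in steps (f y) (map f s2).
  by move=> ps; rewrite steps_map; apply/mapP; exists p.
have fl : last (f y) (map f s2) = c m.
  by rewrite last_map sl /f meet_r ?(flagS fc).
have fw : w <= f y by rewrite lexI wy wm.
(* Whatever is known of the steps of the chain descends to level m. *)
have descend t : t \in T -> (lvl t <= m)%N ->
    (exists2 p, p \in steps \bot s1 & t <= p.2 /\ transverse t p.1) \/
    (t <= f y /\ transverse t w) \/
    (exists2 p, p \in steps (f y) (map f s2) & t <= p.2 /\ transverse t p.1).
  move=> tT; rewrite -le_flag => tm.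
  have [p + [tp pt]] := sT t tT; rewrite stepsE mem_cat inE => /or3P[p1|/eqP pE|p2].
  - by left; exists p.
  - by right; left; rewrite lexI tm andbT; move: tp pt; rewrite pE.
  - right; right; exists (f p.1, f p.2); first exact: fsteps.
    by rewrite lexI tp tm; split=> //; apply: transverse_le pt; exact: leIl.
have [/existsP[k /andP[kT /eqP km]]|nok] := boolP [exists k, (k \in T) && (lvl k == m.+1)].
  have kG := TG' _ kT; have ka := Tna _ kT.
  have pk : pred_lvl k = m by rewrite /pred_lvl km.
  have k0 := building_neq0 bG kG.
  have k_le : k <= c m.+1 by rewrite -pk le_flagS.
  have k_nle : ~~ (k <= c m) by rewrite -pk not_le_flag.
  have truncE : trunc k = k `&` c m by rewrite /trunc pk.
  have [ky kw] : k <= y /\ transverse k w.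
    have [p + [kp pt]] := sT k kT; rewrite stepsE mem_cat inE => /or3P[p1|/eqP pE|p2].
    - have [_ _ _ /s1m p2m] := path_steps s1p p1.
      by case/negP: k_nle; exact: le_trans p2m.
    - by move: kp pt; rewrite pE.
    - have [yp _ _ _] := path_steps ys2 p2.
      case/transverseP: pt => /negP[]; rewrite pk.
      by apply: (enters_le yp); rewrite /enters (meet_l y_le).
  set z := trunc k `|` w.
  have zm : z <= c m by rewrite leUx wm truncE leIr.
  have wz : w <= z := leUr w _.
  have zy : z <= f y by rewrite leUx fw lexI (le_trans (trunc_le k) ky) truncE leIr.
  have z_nw : ~~ (z <= w).
    by case/transverseP: kw => _ + _; apply: contra; apply: le_trans; rewrite leUl.
  have zk : z `|` k = k `|` w by rewrite /z joinC joinA (join_l (trunc_le k)).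
  have := IH (T :\ k) (s1 ++ z :: map f (y :: s2)).
  case.
  - by apply/subsetP => t /setD1P[_ /TG'].
  - by move=> t /setD1P[_ /Tna].
  - by move=> t u /setD1P[_ tT] /setD1P[_ uT]; exact: Tinj.
  - by move=> t u /setD1P[_ tT] /setD1P[_ uT]; exact: Tco.
  - move=> t /setD1P[tk tT]; have := Tm t tT; rewrite leq_eqVlt => /orP[/eqP tm|//].
    by case/negP: tk; apply/eqP/Tinj => //; rewrite tm km.
  - by rewrite cat_path /= s1p wz zy fpath.
  - by rewrite last_cat /= fl.
  - move=> t /setD1P[tk tT]; rewrite steps_cat -/w /= !steps_cons.
    have tm : (lvl t <= m)%N.
      have := Tm t tT; rewrite leq_eqVlt => /orP[/eqP tm|//].
      by case/negP: tk; apply/eqP/Tinj => //; rewrite tm km.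
    have [[p ps tp]|[[ty tw]|[p ps tp]]] := descend t tT tm.
    + by exists p; rewrite // mem_cat ps.
    + have [tz|tz] := boolP (t <= z); first by exists (w, z); rewrite // mem_cat mem_head orbT.
      exists (z, f y); first by rewrite mem_cat !inE eqxx !orbT.
      split=> //=; apply: transverse_join => //; rewrite ?pk //; first exact: TG'.
      * exact: Tna.
      * by rewrite km ltnS.
      * by apply: Tco => //; rewrite km ltnS.
    + by exists p; rewrite // mem_cat !inE ps !orbT.
  move=> s' [sp' sl' ss' sur sat].
  (* Take the first occurrence of z, so that the element before it is not z. *)
  have zs' : z \in s' by apply: ss'; rewrite mem_cat mem_head orbT.
  have [r1 [r2 [sE zr1]]] : exists r1 r2, s' = r1 ++ z :: r2 /\ z \notin r1.
    have := zs'; rewrite -has_pred1 => /split_find[z' r1 r2 /eqP-> zr1].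
    by exists r1, r2; rewrite cat_rcons; split=> //; rewrite -has_pred1.
  subst s'; move: sp' sl'; rewrite cat_path last_cat /= => /and3P[r1p w1z zr2] sl'.
  set w1 := last \bot r1 in w1z.
  have r1z u : u \in r1 -> u <= z.
    by move=> ur; have /andP[_ /le_trans] := path_mem_le r1p ur; apply.
  have r2z u : u \in r2 -> z <= u <= c m.
    by rewrite -sl'; exact: path_mem_le.
  have w_w1 : w <= w1.
    have := mem_last \bot s1; rewrite -/w inE => /orP[/eqP->|ws]; first exact: le0x.
    have := ss' w; rewrite !mem_cat ws => /(_ isT); rewrite inE => /or3P[wr1|/eqP wz'|/r2z/andP[zw _]].
    - by have /andP[] := path_mem_le r1p wr1.
    - by case/negP: z_nw; rewrite wz'.
    - by rewrite zw in z_nw.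
  have w1_k : ~~ (trunc k <= w1).
    apply: contra zr1 => kw1.
    have w1E : w1 = z by apply/le_anti; rewrite w1z leUx kw1.
    have := mem_last \bot r1; rewrite -/w1 w1E inE => /orP[/eqP z0|//].
    by case/negP: z_nw; rewrite z0 le0x.
  have kz : k `&` c m <= z by rewrite -truncE leUl.
  have steps_r2 p : p \in steps z r2 -> [/\ z <= p.1, p.1 <= p.2 & p.2 <= c m].
    by move=> /(path_steps zr2)[]; rewrite sl'.
  exists (r1 ++ map (fun v => v `|` k) (z :: r2)); split.
  - by rewrite cat_path r1p /= path_join // andbT (le_trans w1z) ?leUl.
  - by rewrite last_cat /= (last_map (fun v => v `|` k)) sl' joinC (flag_cover fc).
  - have up u : y <= u -> u <= c m.+1 -> f u \in r1 ++ z :: r2 ->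
        u \in r1 ++ map (fun v => v `|` k) (z :: r2).
      move=> yu um; rewrite mem_cat inE => fur.
      rewrite mem_cat; apply/orP; right; apply/mapP; exists (f u).
        case/or3P: fur => [/r1z fuz|/eqP->|fur]; rewrite ?mem_head //.
          suff -> : f u = z by rewrite mem_head.
          by apply/le_anti; rewrite fuz (le_trans zy) // leI2.
        by rewrite inE fur orbT.
      by rewrite /f (lift_join _ k_nle) // (le_trans ky).
    move=> u; rewrite mem_cat => /orP[us|us].
      have := ss' u; rewrite !mem_cat us => /(_ isT); rewrite inE => /or3P[->//|/eqP uz|/r2z/andP[zu _]].
        by case/negP: z_nw; rewrite -uz ws1.
      by case/negP: z_nw; rewrite (le_trans zu) ?ws1.
    have /andP[yu um] := s2_le u us; apply: up => //; apply: ss'.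
    by rewrite mem_cat inE map_f ?orbT.
  - move=> t tT; rewrite steps_cat -/w1 [steps w1 _]/= steps_cons.
    have [->|tk] := eqVneq t k.
      exists (w1, z `|` k); first by rewrite mem_cat mem_head orbT.
      split=> /=; rewrite ?leUr //.
        by rewrite pk /enters (le_trans _ (le_trans w1z zm)) ?leIl.
      by move=> h hG hk; rewrite zk; case/transverseP: kw => _ _; exact.
    have tm : (lvl t <= m)%N.
      have := Tm t tT; rewrite leq_eqVlt => /orP[/eqP tm|//].
      by case/negP: tk; apply/eqP/Tinj => //; rewrite tm km.
    have tG := TG' _ tT.
    have [|p + tp] := sur t; first by rewrite !inE tk.
    rewrite steps_cat -/w1 steps_cons mem_cat inE => /or3P[p1|/eqP pE|p2].
    + by exists p; rewrite // mem_cat p1.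
    + exists (w1, z `|` k); first by rewrite mem_cat mem_head orbT.
      by rewrite pE in tp; apply: (survives_lift (m := m) (b := false)).
    + exists (p.1 `|` k, p.2 `|` k).
        by rewrite mem_cat inE (steps_map (fun v => v `|` k)) map_f ?orbT.
      have [zp p12 pm] := steps_r2 _ p2.
      apply: (survives_lift (m := m) (b := true)) => //.
      * exact: le_trans kz (le_trans zp p12).
      * by move=> _; exact: le_trans zp.
  - move=> p; rewrite steps_cat -/w1 [steps w1 _]/= steps_cons mem_cat inE.
    have new i0 (q : L * L) : (forall i, (i < m)%N -> enters i q.2 -> ~~ enters i q.1 ->
        i != i0 -> exists2 t, t \in T :\ k & lvl t = i.+1) -> saturated T m.+1 q.
      move=> q0; exists i0 => i; rewrite ltnS leq_eqVlt => /orP[/eqP->|im] e1 e2 ii.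
        by exists k.
      by have [t /setD1P[_ tT] ti] := q0 i im e1 e2 ii; exists t.
    case/or3P => [p1|/eqP->|].
    + by have [|i0 q0] := sat p; [rewrite steps_cat mem_cat p1|exact: (new i0)].
    + have [|i0 q0] := sat (w1, z); first by rewrite steps_cat mem_cat mem_head orbT.
      by apply: (new i0) => i im; rewrite /= (lift_enters (m := m)) //; exact: q0.
    + rewrite (steps_map (fun v => v `|` k)) => /mapP[q qr ->]; have [zq q12 qm] := steps_r2 _ qr.
      have [|i0 q0] := sat q; first by rewrite steps_cat mem_cat inE qr !orbT.
      apply: (new i0) => i im; rewrite /= !(lift_enters (m := m)) //; first exact: q0.
      * exact: le_trans zq.
      * exact: le_trans qm.
      * by rewrite (le_trans kz) // (le_trans zq).
have Tm' : {in T, forall t, (lvl t <= m)%N}.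
  move=> t tT; have := Tm t tT; rewrite leq_eqVlt => /orP[tm|//].
  by case/negP: nok; apply/existsP; exists t; rewrite tT tm.
set z := f y; have zm : z <= c m by exact: leIr.
have := IH T (s1 ++ map f (y :: s2)) TG Tna Tinj Tco Tm'.
case.
- by rewrite cat_path /= s1p fw fpath.
- by rewrite last_cat /= fl.
- move=> t tT; rewrite steps_cat -/w /= steps_cons.
  have [[p ps tp]|[[ty tw]|[p ps tp]]] := descend t tT (Tm' t tT).
  + by exists p; rewrite // mem_cat ps.
  + by exists (w, f y); rewrite // mem_cat mem_head orbT.
  + by exists p; rewrite // mem_cat inE ps !orbT.
move=> s' [sp' sl' ss' sur sat].
have zs' : z \in s' by apply: ss'; rewrite mem_cat mem_head orbT.
have [r1 [r2 sE]] : exists r1 r2, s' = r1 ++ z :: r2.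
  by have [r1 r2] := splitPr zs'; exists r1, r2.
subst s'; move: sp' sl'; rewrite cat_path last_cat /= => /and3P[r1p w1z zr2] sl'.
set w1 := last \bot r1 in w1z.
have r1z u : u \in r1 -> u <= z.
  by move=> ur; have /andP[_ /le_trans] := path_mem_le r1p ur; apply.
have r2z u : u \in r2 -> z <= u <= c m.
  by rewrite -sl'; exact: path_mem_le.
have steps_r2 p : p \in steps z r2 -> [/\ z <= p.1, p.1 <= p.2 & p.2 <= c m].
  by move=> /(path_steps zr2)[]; rewrite sl'.
have zy : z `|` y = y by rewrite join_r ?leIl.
exists (r1 ++ z :: map (fun v => v `|` y) (z :: r2)); split.
- by rewrite cat_path r1p /= w1z leUl path_join.
- by rewrite last_cat /= (last_map (fun v => v `|` y)) sl' joinC (flag_cover fc).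
- move=> u; rewrite mem_cat => /orP[us|us].
    have := ss' u; rewrite !mem_cat us => /(_ isT); rewrite !inE => /or3P[->//|->|/r2z/andP[zu _]].
      by rewrite orbT.
    suff -> : u = z by rewrite eqxx orbT.
    by apply/le_anti; rewrite zu (le_trans (ws1 u us)).
  have /andP[yu um] := s2_le u us.
  rewrite mem_cat inE; apply/or3P; apply: Or33; apply/mapP; exists (f u); last first.
    by rewrite /f (lift_join _ ym).
  have : f u \in r1 ++ z :: r2 by apply: ss'; rewrite mem_cat map_f ?orbT.
  rewrite mem_cat => /orP[/r1z fuz|//].
  suff -> : f u = z by rewrite mem_head.
  by apply/le_anti; rewrite fuz leI2.
- move=> t tT; have tG := TG' _ tT; have tm := Tm' _ tT.
  rewrite steps_cat -/w1 steps_cons [steps z _]/= steps_cons.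
  have [p + tp] := sur t tT.
  rewrite steps_cat -/w1 steps_cons mem_cat inE => /or3P[p1|/eqP pE|p2].
  + by exists p; rewrite // mem_cat p1.
  + by exists (w1, z); rewrite -?pE // mem_cat mem_head orbT.
  + exists (p.1 `|` y, p.2 `|` y).
      by rewrite mem_cat !inE (steps_map (fun v => v `|` y)) map_f ?orbT.
    have [zp p12 pm] := steps_r2 _ p2.
    apply: (survives_lift (m := m) (b := true)) => //; first exact: le_trans zp p12.
- move=> p; rewrite steps_cat -/w1 steps_cons [steps z _]/= steps_cons.
  have new (q : L * L) : enters m q.1 \/ q.2 <= c m -> saturated T m q -> saturated T m.+1 q.
    move=> qm [i0 q0]; exists i0 => i; rewrite ltnS leq_eqVlt => /orP[/eqP->|]; last exact: q0.
    case: qm => [->//|qm]; rewrite /enters => /negP[].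
    by rewrite (le_trans _ qm) ?leIl.
  rewrite mem_cat !inE => /or4P[p1|/eqP->|/eqP->|].
  + apply: new; last by apply: sat; rewrite steps_cat mem_cat p1.
    right; have [_ _ _ /r1z pz] := path_steps r1p p1; exact: le_trans zm.
  + apply: new; first by right.
    by apply: sat; rewrite steps_cat mem_cat mem_head orbT.
  + exists m => i; rewrite ltnS leq_eqVlt => /orP[/eqP->|im]; first by rewrite eqxx.
    by rewrite /= (lift_enters (m := m)) // => ->.
  + rewrite (steps_map (fun v => v `|` y)) => /mapP[q qr ->]; have [zq q12 qm] := steps_r2 _ qr.
    apply: new.
      by left; apply: (enters_le (leUr y _)); rewrite /enters (meet_l y_le).
    have [|i0 q0] := sat q; first by rewrite steps_cat mem_cat inE qr !orbT.
    exists i0 => i im; rewrite /= !(lift_enters (m := m)) //; first exact: q0.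
      exact: le_trans qm.
    exact: le_trans q12.
Qed.


End Flag.

(** * The dragon marriage condition *)

Section Exchange.
Context {d : Order.disp_t} {L : finTBLatticeType d} (gL : geometric L).
Context (I : finType) (v : I -> L).
Implicit Types (x y : L) (U V S A T : {set I}) (mu N : I -> nat) (i a g : I).

Definition weight mu U : nat := (\sum_(i in U) mu i)%N.
Definition join_above x U : L := x `|` \join_(i in U) v i.

(** The condition of Postnikov and of Backman, Eur and Simpson in the interval above
    [x]: among monomials of top degree, it tells those of degree 1 from those of
    degree 0. Testing subsets with full multiplicities is enough. *)
Definition dragon x S mu : bool :=
  [forall U : {set I}, (U \subset S) ==> (0 < weight mu U)%N ==>
     (weight mu U + rank x < rank (join_above x U))%N].

Lemma dragonP x S mu :
  reflect (forall U, U \subset S -> (0 < weight mu U)%N ->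
             (weight mu U + rank x < rank (join_above x U))%N) (dragon x S mu).
Proof.
apply: (iffP forallP) => [h U US U0|h U].
  by have := h U; rewrite US U0.
by apply/implyP => US; apply/implyP; exact: h.
Qed.

Lemma join_setU U V :
  \join_(i in U :|: V) v i = \join_(i in U) v i `|` \join_(i in V) v i.
Proof.
apply/le_anti/andP; split.
  by apply/joinsP => i /setUP[] iU; rewrite ?lexU2 ?(joins_min iU) ?orbT.
by rewrite leUx; apply/andP; split; apply/joinsP => i iU;
  apply: (joins_min (j := i)); rewrite // inE iU ?orbT.
Qed.

Lemma rank_join_above x U V :
  (rank (join_above x (U :|: V)) + rank (join_above x (U :&: V)) <=
   rank (join_above x U) + rank (join_above x V))%N.
Proof.
have := rank_meet_join gL (join_above x U) (join_above x V).
rewrite (_ : join_above x U `|` join_above x V = join_above x (U :|: V)); last first.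
  by rewrite /join_above join_setU joinACA joinxx.
apply: leq_trans; rewrite addnC leq_add2r; apply: rank_le.
rewrite leUx lexI /join_above !leUl /=.
by apply/joinsP => i /setIP[iU iV]; rewrite lexI !lexU2 ?(joins_min iU) ?(joins_min iV) ?orbT.
Qed.

Lemma weight_indic T U : weight (fun i => i \in T) U = #|U :&: T|.
Proof.
rewrite /weight -sum1_card big_mkcond [RHS]big_mkcond /=.
by apply: eq_bigr => i _; rewrite inE; case: (i \in U); case: (i \in T).
Qed.

Lemma weight_delta g U : weight (fun i => i == g) U = (g \in U).
Proof.
rewrite /weight; have [gU|gU] := boolP (g \in U).
  rewrite (bigD1 g) //= eqxx big1 // => i /andP[_ /negbTE->]; by [].
by rewrite big1 // => i iU; case: eqVneq iU gU => // -> ->.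
Qed.

(** The exponents of a term in the expansion of a product of forms [h_g - h_a]
    times the monomial [N]: the forms of the elements of [T] contribute these
    elements, [k] others contribute [g], and the remaining one contributes [b]. *)
Definition exchanged N T k g b : I -> nat :=
  fun i => (N i + (i \in T) + k * (i == g) + (i == b))%N.

Lemma weight_exchanged N T k g b U : weight (exchanged N T k g b) U =
  (weight N U + #|U :&: T| + k * (g \in U) + (b \in U))%N.
Proof.
by rewrite /weight !big_split /= -big_distrr /= -weight_indic -!weight_delta.
Qed.

Lemma weight_setUI N U V :
  (weight N (U :|: V) + weight N (U :&: V) = weight N U + weight N V)%N.
Proof.
rewrite /weight [in LHS]big_mkcond [X in (_ + X = _)%N]big_mkcond.
rewrite [X in (_ = X + _)%N]big_mkcond [X in (_ = _ + X)%N]big_mkcond.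
rewrite -!big_split /=; apply: eq_bigr => i _; rewrite !inE.
by case: (i \in U); case: (i \in V); rewrite //= ?addn0 ?add0n.
Qed.

Lemma weight_sub N U V : U \subset V -> (weight N U <= weight N V)%N.
Proof.
move=> /subsetP UV; rewrite /weight [in leqLHS]big_mkcond [in leqRHS]big_mkcond /=.
by apply: leq_sum => i _; case: ifP => // /UV ->.
Qed.

(** Inside a product of linear forms [h_g - h_b], with [b] in [A], one element [a]
    can be traded for [g] whatever the choices made in the other forms. Let the
    excess of [U] be the rank of its join minus its weight, each element of [A]
    counting once; it is submodular. Take a minimiser [U0] of largest cardinality.
    It does not contain [A] when the condition holds with [g] in place of every
    element of [A] (if it does not, it fails both before and after the trade). Any
    [a] in [A] outside [U0] will do: a set [V] violating the condition after the
    trade contains [a], and [V :|: U0] would be a larger minimiser. *)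
Lemma dragon_exchange x S N A g : A \subset S -> g \in S -> A != set0 ->
  {in A, forall a, v a <= v g} -> v g <= join_above x A ->
  exists2 a, a \in A & forall T k, T \subset A :\ a -> (k + #|T|).+1 = #|A| ->
    dragon x S (exchanged N T k g g) = dragon x S (exchanged N T k g a).
Proof.
move=> AS gS A0 Ag gA.
(* Absorbing A into a set that contains g costs no rank. *)
have absorb U : g \in U -> join_above x (U :|: A) = join_above x U.
  move=> gU; rewrite /join_above join_setU joinA; apply/join_l/joinsP => a aA.
  by rewrite (le_trans (Ag a aA)) // lexU2 // (joins_min gU) ?orbT.
pose base i := (N i + #|A| * (i == g))%N.
have base_w U : weight base U = (weight N U + #|A| * (g \in U))%N.
  by rewrite /weight big_split /= -big_distrr -weight_delta.
have [a0 a0A] := set0Pn _ A0.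
have [no|hb] := boolP (~~ dragon x S base).
  exists a0 => // T k TA kT.
  have none b : b \in g |: A -> dragon x S (exchanged N T k g b) = false.
    move=> bA; apply: contraNF no => /dragonP h; apply/dragonP => U US.
    rewrite base_w; have [gU|gU] := boolP (g \in U); last first.
      rewrite muln0 addn0 => U0; have := h U US; rewrite weight_exchanged (negbTE gU).
      move: (rank _) (rank _) (weight _ _) #|_| (nat_of_bool _) U0.
      by clear=> r1 r2 w t u; lia.
    move=> _; have := h (U :|: A); rewrite subUset US AS absorb // weight_exchanged.
    rewrite inE gU (_ : b \in U :|: A); last first.
      by move: bA; rewrite !inE => /orP[/eqP->|->]; rewrite ?gU ?orbT.
    have -> : (U :|: A) :&: T = T.
      apply/setIidPr/subsetP => t /(subsetP TA); rewrite !inE => /andP[_ ->].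
      by rewrite orbT.
    have := weight_sub N (subsetUl U A).
    move: (weight _ _) (weight _ _) #|T| #|A| kT (rank _) (rank _).
    by clear=> w1 w2 p q kT r1 r2 w12 /(_ isT); lia.
  by rewrite !none // !inE ?eqxx ?a0A ?orbT.
have /dragonP {}hb : dragon x S base by rewrite -[dragon _ _ _]negbK.
pose e U := (weight N U + #|U :&: A|)%N; pose C := e S.
have eC U : U \subset S -> (e U <= C)%N.
  by move=> US; rewrite leq_add ?weight_sub ?subset_leq_card ?setSI.
pose excess U := (rank (join_above x U) + (C - e U))%N.
have [U1 U1S U1min] := arg_minnP (P := fun U : {set I} => U \subset S) excess (sub0set S).
have U1P : (U1 \subset S) && (excess U1 <= excess U1)%N by rewrite U1S leqnn.
have [U0 /andP[U0S U0min] U0max] :=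
  arg_maxnP (P := fun U : {set I} => (U \subset S) && (excess U <= excess U1)%N)
    (fun U : {set I} => #|U|) U1P.
have {}U0max U : U \subset S -> (excess U <= excess U0)%N -> (#|U| <= #|U0|)%N.
  by move=> US UU0; apply: U0max; rewrite US (leq_trans UU0).
have {U1P U1min} U0min U : U \subset S -> (excess U0 <= excess U)%N.
  by move=> /U1min; exact: leq_trans U0min.
have e0 : e set0 = 0 by rewrite /e /weight big_set0 set0I cards0.
have join_above0 : join_above x set0 = x by rewrite /join_above big_set0 joinx0.
have A_gt0 : (0 < #|A|)%N by rewrite card_gt0.
have [a aA aU0] : exists2 a, a \in A & a \notin U0.
  apply/subsetPn/negP => AU0.
  have gU0 : join_above x (g |: U0) = join_above x U0.
    rewrite /join_above join_setU big_set1 joinCA; apply/join_r/(le_trans gA).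
    by rewrite /join_above leU2 // -(setUidPr AU0) join_setU leUl.
  have := hb (g |: U0); rewrite subUset sub1set gS U0S base_w gU0 setU11 muln1.
  have := weight_sub N (subsetUr [set g] U0); have := U0min _ (sub0set S).
  rewrite /excess join_above0 e0 subn0; have := eC _ U0S.
  rewrite /e (setIidPr AU0) -/(e _).
  move: (rank _) (rank _) (weight _ _) (weight _ _) #|A| (C) A_gt0.
  by clear=> r1 r2 w1 w2 p q p0 h1 h2 h3 /(_ isT); lia.
exists a => // T k TA kT.
have aT : a \notin T by apply/negP => /(subsetP TA); rewrite !inE eqxx.
have TA' : T \subset A by apply: subset_trans TA (subD1set _ _).
apply/idP/idP => /dragonP h; apply/dragonP => V VS; rewrite weight_exchanged.
  have [gV|gV] := boolP (g \in V).
    move=> _; have := hb V VS; rewrite base_w gV muln1 muln1.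
    have := subset_leq_card (subsetIr V T); have := leq_b1 (a \in V).
    move: (nat_of_bool _) (rank _) (rank _) (weight _ _) #|_| #|T| #|A| A_gt0 kT.
    by clear=> b r1 r2 w t u p p0 kT b1 tu; lia.
  have := h V VS; rewrite weight_exchanged (negbTE gV) muln0 !addn0.
  have [aV|aV] := boolP (a \in V); last by rewrite addn0.
  move=> _ _; rewrite ltnNge; apply/negP => violated.
  have := U0max (V :|: U0); rewrite subUset VS U0S => /(_ isT) bigger.
  suff /bigger : (excess (V :|: U0) <= excess U0)%N.
    move=> card; case/negP: aU0; have /eqP-> : U0 == V :|: U0.
      by rewrite eqEcard subsetUr card.
    by rewrite inE aV.
  have overlap :
      (rank x + weight N (V :&: U0) + #|V :&: U0 :&: T| <= rank (join_above x (V :&: U0)))%N.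
    have := h (V :&: U0); rewrite subIset ?VS // weight_exchanged.
    rewrite [g \in _]inE (negbTE gV) muln0 !addn0.
    have : (rank x <= rank (join_above x (V :&: U0)))%N by rewrite rank_le ?leUl.
    by move: (rank _) (rank _) (weight _ _) #|_|; clear=> r1 r2 w t; lia.
  have card : (#|V :&: T| + 1 + #|U0 :&: A| <= #|(V :|: U0) :&: A| + #|V :&: U0 :&: T|)%N.
    have <- : #|V :&: (a |: T)| = (#|V :&: T| + 1)%N.
      have -> : V :&: (a |: T) = a |: V :&: T.
        by rewrite setIUr; congr (_ :|: _); apply/setIidPr; rewrite sub1set.
      by rewrite cardsU1 inE (negbTE aT) andbF addnC.
    rewrite -cardsUI leq_add // subset_leq_card //; apply/subsetP => i; rewrite !inE.
      case/orP => [/andP[-> /orP[/eqP->|/(subsetP TA')]]|/andP[-> ->]]; rewrite ?orbT //.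
    case/andP=> /andP[-> iaT] /andP[iU0 _]; rewrite iU0.
    by case/orP: iaT => [/eqP ia|//]; rewrite -ia iU0 in aU0.
  have := rank_join_above x V U0; have := weight_setUI N V U0.
  have := eC _ U0S; have /eC := (VS : V \subset S); move: violated overlap card.
  have := eC (V :|: U0); rewrite subUset VS U0S => /(_ isT).
  rewrite /excess /e; move: (rank _) (rank _) (rank _) (rank _) (rank _) (weight _ _).
  move: (weight _ _) (weight _ _) (weight _ _) #|_| #|_| #|_| #|_| #|_| (C); clear; lia.
have [gV|gV] := boolP (g \in V).
  move=> _; have := h (V :|: A); rewrite subUset VS AS absorb // weight_exchanged.
  rewrite !inE gV aA orbT (_ : (V :|: A) :&: T = T); last first.
    by apply/setIidPr; rewrite (subset_trans TA') ?subsetUr.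
  have := weight_sub N (subsetUl V A); have := subset_leq_card (subsetIr V T).
  move: (rank _) (rank _) (weight _ _) (weight _ _) #|_| #|T| #|A| kT.
  by clear=> r1 r2 w1 w2 t u p kT h1 h2 /(_ isT); lia.
have := h V VS; rewrite weight_exchanged (negbTE gV) muln0 !addn0.
by move: (nat_of_bool _) (rank _) (rank _) (weight _ _) #|_|; clear=> b r1 r2 w t; lia.
Qed.

End Exchange.

(** * The degree on a chain *)

Section Detection.
Context {d : Order.disp_t} {L : finTBLatticeType d} (gL : geometric L).
Context (I : finType) (v : I -> L).
Implicit Types (x y t : L) (p : L * L) (s : seq L) (A T : {set I}) (mu N : I -> nat).

Lemma step_exists x s t : t <= last x s -> ~~ (t <= x) ->
  exists2 p, p \in steps x s & (t <= p.2) && ~~ (t <= p.1).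
Proof.
elim: s x => [|y s IH] x /= tl tx; first by rewrite tl in tx.
have [ty|ty] := boolP (t <= y).
  by exists (x, y); rewrite ?steps_cons ?mem_head //= ty.
by have [p ps pt] := IH y tl ty; exists p; rewrite // steps_cons inE ps orbT.
Qed.

Lemma step_unique (P : pred L) x s p q : {homo P : y z / y <= z >-> (y -> z)} ->
  path <=%O x s -> p \in steps x s -> q \in steps x s ->
  P p.2 -> ~~ P p.1 -> P q.2 -> ~~ P q.1 -> p = q.
Proof.
move=> Pup; elim: s x => [//|y s IH] x /= /andP[xy ys]; rewrite steps_cons !inE.
move=> /orP[/eqP->|ps] /orP[/eqP->|qs] //=.
- by move=> Py _ _ /negP[]; have [yq _ _ _] := path_steps ys qs; exact: Pup Py.
- by move=> _ /negP + Py _; case; have [yp _ _ _] := path_steps ys ps; exact: Pup Py.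
- exact: IH ys ps qs.
Qed.

Definition in_step p : {set I} := [set i | (v i <= p.2) && ~~ (v i <= p.1)].

(** [detects s mu] is the degree of the monomial [mu] on the stratum of the chain
    [s], which is a product over the steps of the chain. *)
Definition detects_step mu p : bool :=
  (weight mu (in_step p) == (rank p.2 - rank p.1).-1)%N &&
  dragon v p.1 (in_step p) mu.

Definition detects s mu : bool := all (detects_step mu) (steps \bot s).

Lemma eq_weight mu mu' (U : {set I}) :
  {in U, mu =1 mu'} -> weight mu U = weight mu' U.
Proof. by move=> mm; apply: eq_bigr. Qed.

Lemma eq_dragon x (S : {set I}) mu mu' : {in S, mu =1 mu'} ->
  dragon v x S mu = dragon v x S mu'.
Proof.
move=> mm; apply/eq_forallb => U; have [US|//] := boolP (U \subset S).
by rewrite (@eq_weight mu mu') // => i /(subsetP US)/mm.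
Qed.

(** All the elements of [A] are below [g], and those that do not enter the chain in
    the same step as [g] are already below the bottom of this step. So [A1], the
    set of those which do, still joins to [g] above it. *)
Lemma detects_exchange s A g : path <=%O \bot s -> last \bot s = \top ->
  v g != \bot -> \join_(a in A) v a = v g ->
  exists2 A1 : {set I}, (A1 \subset A) && (A1 != set0) &
    forall N, exists2 a, a \in A1 & forall T k, T \subset A1 :\ a ->
      (k + #|T|).+1 = #|A1| ->
      detects s (exchanged N T k g g) = detects s (exchanged N T k g a).
Proof.
move=> sp sl g0 jA.
have Ag a : a \in A -> v a <= v g by move=> aA; rewrite -jA (joins_min aA).
have [||p ps /andP[gp2 gp1]] := @step_exists \bot s (v g); rewrite ?sl ?lex1 ?lex0 //.
pose A1 := A :&: in_step p.
have gA1 : v g <= join_above v p.1 A1.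
  rewrite -jA; apply/joinsP => a aA; rewrite /join_above.
  have [ap|ap] := boolP (v a <= p.1); first by rewrite lexU2 // ap.
  rewrite lexU2 // (joins_min (j := a)) ?orbT // !inE aA ap andbT.
  exact: le_trans (Ag a aA) gp2.
have A1A : A1 \subset A := subsetIl _ _.
have A10 : A1 != set0.
  apply: contraNneq gp1 => A10; move: gA1; rewrite A10 /join_above big_set0.
  by rewrite joinx0.
exists A1; first by rewrite A1A.
move=> N; have [||//|||a aA1 ex] := @dragon_exchange _ _ gL _ v p.1 (in_step p) N A1 g.
- exact: subsetIr.
- by rewrite inE gp2.
- by move=> a /(subsetP A1A)/Ag.
- exact: gA1.
exists a => // T k TA kT; apply: eq_in_all => q qs.
have [<-|pq] := eqVneq p q.
  rewrite /detects_step (ex T k TA kT) !weight_exchanged; congr (_ && _).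
  have -> : g \in in_step p by rewrite inE gp2.
  by have -> : a \in in_step p by move: aA1; rewrite inE => /andP[].
have off b : b \in in_step p -> b \notin in_step q.
  rewrite !inE => /andP[b1 b2]; apply/negP => /andP[b3 b4]; case/eqP: pq.
  by apply: (step_unique (P := >= v b) _ sp ps qs) => // y z yz /= /le_trans; exact.
have same : {in in_step q, exchanged N T k g g =1 exchanged N T k g a}.
  move=> i iq; rewrite /exchanged.
  have gq : g \notin in_step q by apply: off; rewrite inE gp2.
  have aq : a \notin in_step q by apply: off; move: aA1; rewrite inE => /andP[].
  have [ig|_] := eqVneq i g; first by rewrite -ig iq in gq.
  by have [ia|_] := eqVneq i a; first by rewrite -ia iq in aq.
by rewrite /detects_step (eq_weight same) (eq_dragon _ same).
Qed.

Lemma detects_atom s mu i : last \bot s = \top -> is_atom (v i) ->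
  (0 < mu i)%N -> detects s mu = false.
Proof.
move=> sl ia mui; apply/negP => /allP ok.
have [||p ps /andP[ip2 ip1]] := @step_exists \bot s (v i).
- by rewrite sl lex1.
- by rewrite lex0 atom_gt0.
have /andP[_ /dragonP/(_ [set i])] := ok p ps.
rewrite sub1set inE ip2 ip1 /weight /join_above !big_set1 => /(_ isT mui).
have := rank_join_atom gL p.1 ia; move: (rank _) (rank _) (mu i) mui.
by clear; lia.
Qed.

End Detection.

Local Open Scope ring_scope.

Section DegreeFunctional.
Context {d : Order.disp_t} {L : finTBLatticeType d} (gL : geometric L).
Context (I : finType) (v : I -> L) (s : seq L).
Hypotheses (sp : path (<=%O : rel L) \bot%O s) (sl : last \bot%O s = \top%O).
Let n := #|{: I}|.
Implicit Types (p q : {mpoly int[n]}) (m : 'X_{1..n}).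

Definition mult m : I -> nat := fun i => m (enum_rank i).

Definition chain_degree p : int :=
  \sum_(m <- msupp p) p@_m *+ detects v s (mult m).

Lemma chain_degree_big p (r : seq 'X_{1..n}) : uniq r -> {subset msupp p <= r} ->
  chain_degree p = \sum_(m <- r) p@_m *+ detects v s (mult m).
Proof.
move=> ur pr; rewrite [RHS](bigID (mem (msupp p))) /= [X in _ + X]big1 ?addr0.
  rewrite -[RHS]big_filter; apply: perm_big; apply: uniq_perm => //.
    exact: filter_uniq.
  by move=> m; rewrite mem_filter; have [/pr->|] := boolP (m \in msupp p).
by move=> m mp; rewrite memN_msupp_eq0 // mul0rn.
Qed.

Lemma chain_degree0 : chain_degree 0 = 0.
Proof. by rewrite /chain_degree msupp0 big_nil. Qed.

Lemma chain_degreeD p q : chain_degree (p + q) = chain_degree p + chain_degree q.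
Proof.
pose r := undup (msupp p ++ msupp q).
have rP m : (m \in r) = (m \in msupp p) || (m \in msupp q).
  by rewrite mem_undup mem_cat.
rewrite !(@chain_degree_big _ r) ?undup_uniq //; last 3 first.
- by move=> m mq; rewrite rP mq orbT.
- by move=> m mp; rewrite rP mp.
- by move=> m /msuppD_le; rewrite rP mem_cat.
by rewrite -big_split; apply: eq_bigr => m _; rewrite mcoeffD mulrnDl.
Qed.

Lemma chain_degreeZ c p : chain_degree (c *: p) = c * chain_degree p.
Proof.
rewrite (@chain_degree_big _ (msupp p)) ?msupp_uniq //; last first.
  by move=> m; exact: msuppZ_le.
by rewrite mulr_sumr; apply: eq_bigr => m _; rewrite mcoeffZ mulrnAr.
Qed.

Lemma chain_degreeX m : chain_degree 'X_[m] = (detects v s (mult m))%:R.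
Proof. by rewrite /chain_degree msuppX big_seq1 mcoeffX eqxx. Qed.

Lemma chain_degreeB p q : chain_degree (p - q) = chain_degree p - chain_degree q.
Proof. by rewrite chain_degreeD -scaleN1r chain_degreeZ mulN1r. Qed.

Lemma chain_degreeM0 p q : (forall m, chain_degree ('X_[m] * q) = 0) ->
  chain_degree (p * q) = 0.
Proof.
move=> q0; rewrite {1}(mpolyE p) mulr_suml.
rewrite (big_morph _ chain_degreeD chain_degree0) big1 // => m _.
by rewrite -scalerAl chain_degreeZ q0 mulr0.
Qed.

Definition var i : {mpoly int[n]} := 'X_(enum_rank i).

Lemma mult_addU m i : mult (m + U_(enum_rank i)) = (fun j => mult m j + (j == i))%N.
Proof.
apply/funext => j; rewrite /mult mnmDE mnm1E.
by rewrite (inj_eq enum_rank_inj) eq_sym.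
Qed.

Lemma chain_degree_atom p i : is_atom (v i) -> chain_degree (p * var i) = 0.
Proof.
move=> ia; apply: chain_degreeM0 => m; rewrite -mpolyXD chain_degreeX.
by rewrite (detects_atom gL (i := i)) // mult_addU eqxx addn1.
Qed.

(** The factors indexed by [A1] suffice: by [detects_exchange], the two terms of the
    factor of [a] cancel in the expansion. *)
Lemma chain_degree_antichain p (A : {set I}) g : v g != \bot%O ->
  (\join_(a in A) v a)%O = v g ->
  chain_degree (p * \prod_(a in A) (var g - var a)) = 0.
Proof.
move=> g0 jA; have [A1 /andP[A1A A10] ex] := detects_exchange gL sp sl g0 jA.
have -> : \prod_(a in A) (var g - var a) =
    \prod_(a in A :\: A1) (var g - var a) * \prod_(a in A1) (var g - var a).
  by rewrite (big_setID A1) /= (setIidPr A1A) mulrC.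
rewrite mulrA; apply: chain_degreeM0 => m; have [a aA1 {}ex] := ex (mult m).
rewrite (big_setD1 a) //= -big_enum /=.
(* The factors other than that of a are expanded one by one: T collects the
   elements b, and k counts the copies of g, chosen so far. *)
suff expand (r : seq I) (T : {set I}) k m' : uniq r -> {in r, forall b, b \notin T} ->
    T \subset A1 :\ a -> {subset r <= A1 :\ a} -> (k + #|T| + size r).+1 = #|A1| ->
    mult m' = (fun i => mult m i + (i \in T) + k * (i == g))%N ->
    chain_degree ('X_[m'] * ((var g - var a) * \prod_(b <- r) (var g - var b))) = 0.
  apply: (expand _ set0 0); rewrite ?enum_uniq ?sub0set //.
  - by move=> b _; rewrite inE.
  - by move=> b; rewrite mem_enum.
  - by rewrite cards0 -cardE (cardsD1 a A1) aA1.
  - by apply/funext => i; rewrite inE !addn0.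
elim: r T k m' => [|b r IH] T k m' + rT TA rA kT mE.
  move=> _; rewrite big_nil mulr1 mulrBr -!mpolyXD chain_degreeB !chain_degreeX !mult_addU mE.
  by rewrite addn0 in kT; rewrite (ex T k TA kT) subrr.
move=> /= /andP[br ur]; have bT := rT b (mem_head b r); have bA := rA b (mem_head b r).
have rA' : {subset r <= A1 :\ a} by move=> i ir; apply: rA; rewrite inE ir orbT.
rewrite big_cons (mulrCA (var g - var a)) (mulrA 'X_[m']) (mulrBr 'X_[m']) mulrBl.
rewrite -!mpolyXD chain_degreeB.
rewrite (IH T k.+1) ?(IH (b |: T) k) ?subrr //.
- by move=> i ir; rewrite !inE negb_or rT ?inE ?ir ?orbT // andbT; apply: contraNneq br => <-.
- by rewrite subUset sub1set bA.
- by rewrite cardsU1 bT -kT /= add1n !addnS addSn.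
- rewrite mult_addU mE; apply/funext => i; rewrite in_setU1.
  by have [->|_] := eqVneq i b; rewrite ?(negbTE bT) /= addn0 // addnAC.
- by move=> i ir; apply: rT; rewrite inE ir orbT.
- by rewrite -kT /= addnS !addSn.
- by rewrite mult_addU mE; apply/funext => i; rewrite mulSn addnA addnAC.
Qed.

End DegreeFunctional.

Local Open Scope order_scope.

(** * Triangularity *)

Section Triangularity.
Context {d : Order.disp_t} {L : finTBLatticeType d} (gL : geometric L).
Context (G : {set L}) (bG : building_set G).
Context (c : nat -> L) (n : nat) (fc : modular_flag G c n).
Context (I : finType) (v : I -> L) (vG : forall i, v i \in G).
Context (s : seq L) (T : {set I}).
Local Notation lvl := (lvl fc).
Local Notation pred_lvl := (pred_lvl fc).
Hypotheses (sp : path (<=%O : rel L) \bot s) (sl : last \bot s = \top).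
Hypothesis (Tinj : {in T &, injective (lvl \o v)}).
Hypothesis (sur : {in T, forall t, exists2 p, p \in steps \bot s & survives fc (v t) p}).
Hypothesis (sat : {in steps \bot s, forall p, saturated fc (v @: T) n p}).
Implicit Types (x y : L) (p : L * L) (i t : I) (mu : I -> nat) (j l : nat).

Let v0 i : v i != \bot := building_neq0 bG (vG i).

Definition new_level p j := enters c j p.2 && ~~ enters c j p.1.

Lemma rank_new_levels x y l : x <= y ->
  rank (y `&` c l) = (rank (x `&` c l) + count (new_level (x, y)) (iota 0 l))%N.
Proof.
move=> xy; elim: l => [|l IH]; first by rewrite (flag0 fc) !meetx0 addn0.
rewrite !(rank_enters gL fc) IH -addn1 iotaD count_cat /= addn0 /new_level /=.
have := enters_le (i := l) (c := c) xy.
case: (enters c l x) => [/(_ isT)->|_]; rewrite ?andbF ?andbT ?addn0 /= -?addnA //.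
  by congr (_ + _)%N; rewrite addnC.
Qed.

Lemma survives_in_step p t : p \in steps \bot s -> t \in T -> t \in in_step v p ->
  survives fc (v t) p.
Proof.
move=> ps tT; rewrite inE => /andP[t2 t1]; have [q qs qt] := sur tT.
suff -> : p = q by [].
have [tq2 tq _ _] := qt.
apply: (step_unique (P := >= v t) _ sp ps qs) => //.
  by move=> y z yz /= /le_trans; exact.
by apply: contra tq; exact: entersP.
Qed.

Lemma new_level_occupied p j t : p \in steps \bot s -> t \in T ->
  lvl (v t) = j.+1 -> new_level p j -> t \in in_step v p.
Proof.
move=> ps tT tj /andP[j2 j1]; have [q qs [tq2 tq _ _]] := sur tT.
have pj : pred_lvl (v t) = j by rewrite /pred_lvl tj.
have -> : p = q.
  apply: (step_unique (P := enters c j) _ sp ps qs) => //.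
  - by move=> y z yz; exact: enters_le.
  - by rewrite -pj entersP.
  - by rewrite -pj.
rewrite inE tq2; apply: contra tq; exact: entersP.
Qed.

Definition indic : I -> nat := fun i => i \in T.

Definition upto l p : {set I} := [set i in in_step v p | (lvl (v i) <= l)%N].

Lemma in_upto l p i : (i \in upto l p) = (i \in in_step v p) && (lvl (v i) <= l)%N.
Proof. by rewrite inE. Qed.

(** This bound and the next one compare any detected monomial with [T], level by
    level and step by step. *)
Lemma upto_saturated p l : p \in steps \bot s -> (l <= n)%N ->
  ((rank (p.2 `&` c l) - rank (p.1 `&` c l)).-1 <= weight indic (upto l p))%N.
Proof.
move=> ps ln; have [_ p12 _ _] := path_steps sp ps.
rewrite (rank_new_levels l p12) addKn -surjective_pairing.
have [j0 j0P] := sat ps; rewrite [weight indic _]weight_indic.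
pose D := rem j0 [seq j <- iota 0 l | new_level p j].
have uD : uniq [seq j <- iota 0 l | new_level p j] by rewrite filter_uniq ?iota_uniq.
have D_count : ((count (new_level p) (iota 0 l)).-1 <= size D)%N.
  rewrite -size_filter /D; have [jD|jD] := boolP (j0 \in [seq j <- iota 0 l | new_level p j]).
    by rewrite size_rem.
  by rewrite rem_id // leq_pred.
apply: leq_trans D_count _; rewrite cardE -(size_map (pred_lvl \o v)).
apply: uniq_leq_size; first exact: rem_uniq.
move=> j; rewrite mem_rem_uniq // inE mem_filter mem_iota /= add0n => /and3P[jj0 jnew jl].
have /andP[j2 j1] := jnew.
have [t /imsetP[i iT ->] ij] := j0P j (leq_trans jl ln) j2 j1 jj0.
apply/mapP; exists i; last by rewrite /= /pred_lvl ij.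
rewrite mem_enum !inE iT ij jl !andbT.
by have := new_level_occupied ps iT ij jnew; rewrite inE.
Qed.

Lemma upto_detected mu p l : p \in steps \bot s -> detects_step v mu p ->
  (weight mu (upto l p) <= (rank (p.2 `&` c l) - rank (p.1 `&` c l)).-1)%N.
Proof.
move=> ps /andP[_ /dragonP dr]; have [_ p12 _ _] := path_steps sp ps.
have [->//|w0] := posnP (weight mu (upto l p)).
have US : upto l p \subset in_step v p by apply/subsetP => i; rewrite inE => /andP[].
have := dr _ US w0; set r := rank (join_above _ _ _).
have : (r <= rank (p.1 `|` (p.2 `&` c l)))%N.
  apply: rank_le; rewrite leU2 //; apply/joinsP => i; rewrite !inE.
  by rewrite -(le_flag fc) lexI => /andP[/andP[-> _] ->].
have := rank_meet_join gL p.1 (p.2 `&` c l); rewrite meetA (meet_l p12).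
move: (rank _) (rank _) (rank _) (rank _) (weight _ _) (r) w0.
by clear; lia.
Qed.

(** The elements of [U] in [T] enter distinct new levels; below the lowest of these
    levels, its element [t] contributes one more, because [trunc t] does not lie
    below [p.1]. *)
Lemma dragon_indic p : p \in steps \bot s -> dragon v p.1 (in_step v p) indic.
Proof.
move=> ps; apply/dragonP => U /subsetP US; rewrite [weight indic _]weight_indic.
case/card_gt0P => t1 t1U.
have [t tU tmin] := arg_minnP (P := mem (U :&: T)) (lvl \o v) t1U.
have /setIP[tU' tT] : t \in U :&: T := tU.
set j := pred_lvl (v t); set x := p.1; set J := join_above v x U.
have xJ : x <= J := leUl _ _.
have UJ i : i \in U -> v i <= J by move=> iU; rewrite lexU2 // (joins_min iU) ?orbT.
have jn : (j <= n)%N by rewrite (leq_trans (leq_pred _)) ?lvl_len.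
have := rank_new_levels n xJ; rewrite (flagT fc) !meetx1 => ->.
rewrite addnC ltn_add2l -(subnKC jn) iotaD count_cat add0n.
have [_ tx ttx _] := survives_in_step ps tT (US _ tU').
apply: (@leq_add 1).
  rewrite -(ltn_add2l (rank (x `&` c j))) addn0 -rank_new_levels //.
  apply: rank_lt; rewrite lt_neqAle leI2 // andbT.
  apply: contraNneq ttx => xE; apply: (le_trans _ (leIl x (c j))).
  by rewrite xE /trunc leI2 // UJ.
rewrite -size_filter cardE -(size_map (pred_lvl \o v)); apply: uniq_leq_size.
  rewrite map_inj_in_uniq ?enum_uniq // => a b; rewrite !mem_enum.
  move=> /setIP[_ aT] /setIP[_ bT] ab.
  by apply: Tinj => //=; rewrite !(lvlK fc) //; congr _.+1.
move=> k /mapP[a]; rewrite mem_enum => /[dup] aUT /setIP[aU aT] ->.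
rewrite mem_filter mem_iota subnKC //= /new_level /= entersP ?UJ //.
have [_ -> _ _] := survives_in_step ps aT (US _ aU); rewrite /=.
have := tmin a aUT; rewrite /= /j /pred_lvl => ta.
have := lvl_len fc (v a); have : (0 < lvl (v a))%N by rewrite lvl_gt0.
by move: (lvl (v a)) (lvl (v t)) ta; clear; lia.
Qed.

Lemma detects_indic : detects v s indic.
Proof.
apply/allP => p ps; rewrite /detects_step dragon_indic // andbT.
have [_ p12 _ _] := path_steps sp ps; have /dragonP dr := dragon_indic ps.
rewrite eqn_leq; apply/andP; split.
  have [->//|w0] := posnP (weight indic (in_step v p)).
  have := dr _ (subxx _) w0.
  have : (rank (join_above v p.1 (in_step v p)) <= rank p.2)%N.
    by apply: rank_le; rewrite leUx p12; apply/joinsP => i; rewrite inE => /andP[].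
  by move: (rank _) (rank _) (rank _) (weight _ _) w0; clear; lia.
have := upto_saturated ps (leqnn n); rewrite (flagT fc) !meetx1.
move/leq_trans; apply; apply: weight_sub; apply/subsetP => i; rewrite inE.
by case/andP.
Qed.

Lemma sum_upto mu l : (\sum_(p <- steps \bot s) weight mu (upto l p) =
  \sum_(i | lvl (v i) <= l) mu i)%N.
Proof.
have one i x r : ~~ (v i <= x) -> path <=%O x r -> v i <= last x r ->
    (\sum_(p <- steps x r) (i \in in_step v p) = 1)%N.
  elim: r x => [|y r IH] x ix /=; first by rewrite (negbTE ix).
  case/andP=> xy yr il; rewrite steps_cons big_cons inE /= ix andbT.
  have [iy|iy] := boolP (v i <= y); last by rewrite IH.
  rewrite big_seq big1 // => p pr; have [yp _ _ _] := path_steps yr pr.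
  by rewrite inE (le_trans iy yp) andbF.
under eq_bigr do rewrite /weight big_mkcond /=.
rewrite exchange_big /= [RHS]big_mkcond; apply: eq_bigr => i _.
have [il|il] := boolP (lvl (v i) <= l)%N; last first.
  by rewrite big1 // => p _; rewrite inE (negbTE il) andbF.
rewrite -[RHS]muln1 -(one i \bot s) ?lex0 ?sl ?lex1 // big_distrr /=.
apply: eq_bigr => p _; rewrite [i \in upto _ _]inE il andbT.
by case: (_ \in _); rewrite ?muln1 ?muln0.
Qed.

Lemma detects_total mu : detects v s mu -> (\sum_i mu i = \sum_i indic i)%N.
Proof.
move=> /allP dmu; have /allP dT := detects_indic.
have full_l p : upto n p = in_step v p.
  by apply/setP => i; rewrite inE lvl_len andbT.
have all_l m : (\sum_i m i = \sum_(i | lvl (v i) <= n) m i)%N.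
  by apply: eq_bigl => i; rewrite lvl_len.
rewrite !all_l -!sum_upto; rewrite big_seq [RHS]big_seq; apply: eq_bigr => p ps.
by rewrite full_l; have /andP[/eqP-> _] := dmu p ps; have /andP[/eqP-> _] := dT p ps.
Qed.

(** If [mu] agrees with [T] on the levels above that of [k], detection makes the
    level counts of [mu] and [T] agree step by step; so [mu] has an element of the
    level of [k] in the step of [k], necessarily below [k]. *)
Lemma detects_leading mu k : k \in T -> mu k = 0 ->
  (forall i, (lvl (v k) < lvl (v i))%N -> mu i = indic i) ->
  (forall i, lvl (v i) = lvl (v k) -> v i <= v k -> i != k -> mu i = 0) ->
  ~~ detects v s mu.
Proof.
move=> kT muk above below; apply/negP => /[dup] /detects_total total /allP dmu.
set l := lvl (v k).
have low : (\sum_(p <- steps \bot s) weight mu (upto l p) =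
            \sum_(p <- steps \bot s) weight indic (upto l p))%N.
  rewrite !sum_upto; move: total.
  rewrite (bigID (fun i => lvl (v i) <= l)%N) /= [RHS](bigID (fun i => lvl (v i) <= l)%N) /=.
  rewrite (eq_bigr indic (P := fun i => ~~ (lvl (v i) <= l)%N)); first by move/addIn.
  by move=> i; rewrite -ltnNge; exact: above.
have le_l j p : p \in steps \bot s -> (j <= n)%N ->
    (weight mu (upto j p) <= weight indic (upto j p))%N.
  by move=> ps jn; apply: leq_trans (upto_detected j ps (dmu p ps)) (upto_saturated ps jn).
have ln : (l <= n)%N by exact: lvl_len.
have [p ps [k2 k1 _ kmax]] := sur kT.
have kp : k \in in_step v p.
  by rewrite inE k2; apply: contra k1; exact: entersP.
have eq_l : weight mu (upto l p) = weight indic (upto l p).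
  move: low; rewrite !(big_rem p ps) /=; 
  set f := (\sum_(q <- _) _)%N; set g := (\sum_(q <- _) _)%N.
  have : (f <= g)%N.
    rewrite /f /g big_seq [leqRHS]big_seq; apply: leq_sum => q qs.
    by apply: le_l => //; exact: mem_rem qs.
  by have := le_l l p ps ln; move: (weight _ _) (weight _ _) (f) (g); clear; lia.
have drop : (weight indic (upto l.-1 p) < weight indic (upto l p))%N.
  have lp : l = l.-1.+1 by rewrite prednK // lvl_gt0.
  rewrite /weight [ltnRHS](bigD1 k) /=; last by rewrite inE kp leqnn.
  rewrite (_ : indic k = 1%N) ?add1n; last by rewrite /indic kT.
  rewrite ltnS [leqLHS]big_mkcond [leqRHS]big_mkcond /=.
  apply: leq_sum => i _; rewrite !inE; case: ifP => // /andP[-> il].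
  rewrite (leq_trans il) ?leq_pred //=; case: eqVneq => [ik|//].
  by move: il; rewrite ik -/l {1}lp ltnn.
have [i /and3P[ip il mui]] : exists i, [&& i \in in_step v p, lvl (v i) == l & (0 < mu i)%N].
  apply/existsP; apply: contraLR drop => /existsPn none; rewrite -leqNgt -eq_l.
  apply: leq_trans (le_l l.-1 p ps (leq_trans (leq_pred _) ln)).
  rewrite /weight [leqLHS]big_mkcond [leqRHS]big_mkcond /=.
  apply: leq_sum => i _; rewrite !in_upto; have := none i.
  case: (i \in in_step v p) => //=; have [->|il] := eqVneq (lvl (v i)) l.
    by rewrite leqnn -leqNgt leqn0 => /eqP->; case: ifP.
  move=> _; case: ifP => // il'; rewrite ifT //.
  by move: il il'; move: (lvl _) (l); clear; lia.
have ik : v i <= v k by apply: kmax => //; [exact/eqP | move: ip; rewrite inE => /andP[]].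
move: mui; have [->|ik'] := eqVneq i k; first by rewrite muk.
by rewrite below // (eqP il).
Qed.

End Triangularity.

(** * The flag of a supersolvable lattice *)

Section CompleteFlag.
Context {d : Order.disp_t} {L : finTBLatticeType d} (gL : geometric L).
Context (G : {set L}) (bG : building_set G).
Implicit Types (x y a h : L).

Lemma exists_modular_flag (C : {set L}) :
  is_maximal_chain \bot \top C -> {in C, forall x, modular_element x} ->
  (forall g x, g \in G -> x \in C -> x `&` g \in G \/ x `&` g = \bot) ->
  exists c, modular_flag G c (rank (\top : L)).
Proof.
move=> maxC modC meetC; set n := rank (\top : L).
have ranks i : (i <= n)%N -> exists2 x, x \in C & rank x = i.
  exact: maximal_chain_ranks.
pose c i := odflt \top [pick x in C | rank x == i].
have cP i : (i <= n)%N -> c i \in C /\ rank (c i) = i.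
  move=> /ranks[x xC xi]; rewrite /c; case: pickP => [y /andP[yC /eqP]//|/(_ x)].
  by rewrite xC xi eqxx.
have cT i : (n <= i)%N -> c i = \top.
  move=> ni; rewrite /c; case: pickP => [y /andP[_ /eqP yi]|//].
  by apply: rank_eq; rewrite ?lex1 // yi.
have cC i : c i \in C.
  have [/cP[]//|/ltnW ni] := leqP i n; rewrite cT //.
  by have [] := cP n (leqnn n); rewrite (cT n).
have comp : {in C &, forall x y, x >=< y}.
  move=> x y xC yC; have /maxsetP[/andP[_ /forall_inP Cc] _] := maxC.
  by have /forall_inP := Cc x xC; exact.
exists c; split.
- by apply/eqP; rewrite -[_ == _]negbK -rank_gt0 // (cP 0%N _).2.
- exact: cT.
- move=> i; have [ni|ni] := leqP n i; first by rewrite cT // cT // leqW.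
  case/orP: (comp _ _ (cC i) (cC i.+1)) => // ii.
  by have := rank_le ii; rewrite (cP i _).2 ?(cP i.+1 _).2 ?ltnn // ltnW.
- move=> i a ai ani; have [ni|ni] := leqP n i.
    by case/negP: ani; rewrite cT // lex1.
  have ii : c i <= c i.+1.
    case/orP: (comp _ _ (cC i) (cC i.+1)) => // ii.
    by have := rank_le ii; rewrite (cP i _).2 ?(cP i.+1 _).2 ?ltnn // ltnW.
  apply: rank_eq; first by rewrite leUx ai.
  rewrite (cP i.+1 _).2 // -[i in (i < _)%N](cP i _).2 ?rank_lt ?(ltnW ni) //.
  by rewrite lt_neqAle leUr andbT eq_sym eq_joinr.
- by move=> i; exact: modC.
- by move=> i g gG; exact: meetC.
Qed.

Context (c : nat -> L) (n : nat) (fc : modular_flag G c n).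
Local Notation lvl := (lvl fc).

(** Each condition of transversality provides [h] when it fails: the trace of
    [x `|` a] on the flag below the level of [x], an atom of [x], or the join of [x]
    with another member of its level. *)
Lemma not_transverse x a : x \in G -> ~~ is_atom x -> x `|` a \in G ->
  ~~ (x <= a) -> ~~ transverse fc x a ->
  exists h, [/\ h \in G, h `|` a = x `|` a &
    [\/ is_atom h, (lvl h < lvl x)%N | lvl h = lvl x /\ x < h]].
Proof.
move=> xG xna xaG xa; have x0 := building_neq0 bG xG.
rewrite /transverse !negb_and !negbK => /or3P[enter|trunc_a|].
- set j := pred_lvl fc x in enter.
  have xj : x <= a `|` c j.
    rewrite (le_trans (le_flagS fc x)) // -/j.
    by rewrite -(flag_cover fc (leIr (c j.+1) a) enter) leU2 ?leIl.
  pose h := (x `|` a) `&` c j.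
  have ha : h `|` a = x `|` a.
    case: (flag_modular fc j (x `|` a)) => /(_ a (leUr a x)) + _.
    have -> : (a `|` c j) `&` (x `|` a) = x `|` a by rewrite meet_r // leUx xj leUl.
    by move=> aE; rewrite -[RHS]aE joinC /h meetC.
  have h0 : h != \bot.
    apply: contraNneq xa => h0; move: ha; rewrite h0 join0x => ->.
    exact: leUl.
  exists h; split=> //; first exact: (meet_flag_in fc).
  by apply: Or32; rewrite (lvlK fc x0) -/j ltnS -le_flag leIr.
- have [h [hat hx ht]] : exists h, [/\ is_atom h, h <= x & ~~ (h <= trunc fc x)].
    apply: atom_separates => //; apply/negP => /rank_le.
    by rewrite (rank_trunc gL fc x0) ltnn.
  exists h; split; [exact: atom_in_building| |exact: Or31].
  have xE : trunc fc x `|` h = x.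
    apply: rank_eq; first by rewrite leUx trunc_le hx.
    by rewrite (rank_join_atomN gL hat ht) (rank_trunc gL fc x0).
  apply/le_anti; rewrite leU2 //= leUx leUr andbT -{1}xE leUx leUl andbT.
  by rewrite (le_trans trunc_a) ?leUr.
- rewrite negb_forall => /existsP[k]; rewrite !negb_imply -!andbA.
  case/and4P => kG /eqP kx kxa nkx; exists (x `|` k); split.
  + exact: (same_level_join gL bG (fc := fc)).
  + by rewrite joinAC; apply: join_l.
  + apply: Or33; split; last by rewrite lt_neqAle leUl andbT eq_sym eq_joinl.
    apply/eqP; rewrite eqn_leq -le_flag leUx lvl_le -[in c _]kx lvl_le /=.
    by rewrite lvl_mono ?leUl.
Qed.

End CompleteFlag.

Local Open Scope ring_scope.

(** * The presentation on the members that are not atoms *)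

Lemma ideal_gen_sub (R : comNzRingType) (S S' : R -> Prop) p :
  (forall q, S q -> ideal_gen S' q) -> ideal_gen S p -> ideal_gen S' p.
Proof.
move=> SS' [r rS ->]; elim: r rS => [|a r IH] rS.
  by rewrite big_nil; exact: ideal_gen0.
rewrite big_cons; apply: ideal_gen_lin; first by apply/SS'/rS; rewrite mem_head.
by apply: IH => b br; apply: rS; rewrite inE br orbT.
Qed.

Lemma ideal_gen_mem (R : comNzRingType) (S : R -> Prop) a p :
  S p -> ideal_gen S (a * p).
Proof.
by exists [:: (a, p)]; [move=> b /[!inE]/eqP-> | rewrite big_seq1].
Qed.

Lemma rmorph_mpoly_eq k (R : comNzRingType) (f g : {rmorphism {mpoly int[k]} -> R}) :
  (forall i, f 'X_i = g 'X_i) -> f =1 g.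
Proof.
move=> fg p; rewrite (mpolyE p) !rmorph_sum; apply: eq_bigr => m _ /=.
rewrite -mul_mpolyC !rmorphM; congr (_ * _).
  by rewrite -[p@_m]intz !rmorph_int.
rewrite mpolyXE_id !rmorph_prod; apply: eq_bigr => i _.
by rewrite !rmorphXn fg.
Qed.

Lemma rmorph_prodB (R S : comNzRingType) (f : {rmorphism R -> S}) x y z t :
  f ((x - y) * (z - t)) = (f x - f y) * (f z - f t).
Proof. by rewrite rmorphM !rmorphB. Qed.

Lemma mlead_mul1 k (p q : {mpoly int[k]}) m m' : mlead p = m -> mleadc p = 1 ->
  mlead q = m' -> mleadc q = 1 ->
  mlead (p * q) = (m + m')%MM /\ mleadc (p * q) = 1.
Proof.
move=> <- p1 <- q1; have nz (r : {mpoly int[k]}) : mleadc r = 1 -> r != 0.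
  by move=> r1; rewrite -mleadc_eq0 r1 oner_eq0.
by rewrite (mleadM (nz _ p1) (nz _ q1)) mleadcM p1 q1 mul1r.
Qed.

Lemma pihomog_multiple k e l (p q : {mpoly int[k]}) : q \is e.-homog ->
  exists r, pihomog mdeg l (p * q) = r * q.
Proof.
move=> qe; exists (\sum_(m <- msupp p) (if (mdeg m + e == l)%N then p@_m *: 'X_[m] else 0)).
rewrite {1}(mpolyE p) mulr_suml linear_sum mulr_suml; apply: eq_bigr => m _ /=.
have mh : p@_m *: 'X_[m] * q \is (mdeg m + e).-homog.
  by rewrite dhomogM // dhomogZ // dhomogX.
have [<-|ml] := eqVneq (mdeg m + e)%N l; first by rewrite pihomog_dE.
by rewrite (pihomog_ne0 ml mh) mul0r.
Qed.

Section Presentation.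
Context {d : Order.disp_t} (B : builtLattice d).
Context (c : nat -> B) (n : nat) (fc : modular_flag (bset B) c n).
Let gL := built_geometric B.
Let bG := built_building B.
Local Notation I := (bidx B).
Local Notation lvl := (lvl fc).
Implicit Types (i g : I) (A : {set I}).

(** A larger key means an earlier, hence larger, variable. *)
Definition key i : nat := (lvl (val i) * (rank (\top : B)%O).+1 +
  ((rank (\top : B)%O) - rank (val i)))%N.

Definition vars : seq I :=
  locked (sort (fun a b => key b <= key a)%N (enum [pred i : I | ~~ is_atom (val i)])).

Definition nv := size vars.

Definition elt (j : 'I_nv) : I := tnth (in_tuple vars) j.

Definition gen i : {mpoly int[nv]} :=
  locked (if insub (index i vars) is Some j then 'X_j else 0).

Lemma mem_vars i : (i \in vars) = ~~ is_atom (val i).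
Proof. by rewrite /vars -lock mem_sort mem_enum. Qed.

Lemma vars_uniq : uniq vars.
Proof. by rewrite /vars -lock sort_uniq enum_uniq. Qed.

Lemma elt_inj : injective elt.
Proof.
move=> j k jk; apply/val_inj/eqP.
rewrite -(nth_uniq (elt j) (ltn_ord j) (ltn_ord k) vars_uniq).
by rewrite -!(tnth_nth (elt j) (in_tuple vars)) -/(elt j) -/(elt k) jk.
Qed.

Lemma elt_not_atom j : ~~ is_atom (val (elt j)).
Proof. by rewrite -mem_vars mem_tnth. Qed.

Lemma elt_onto i : ~~ is_atom (val i) -> exists j, i = elt j.
Proof.
rewrite -mem_vars => iv; have := iv; rewrite -index_mem => lt.
by exists (Ordinal lt); rewrite /elt (tnth_nth i) /= nth_index.
Qed.

Lemma gen_elt j : gen (elt j) = 'X_j.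
Proof.
rewrite /gen -lock /elt (tnth_nth (elt j)) index_uniq ?vars_uniq //=.
by rewrite valK.
Qed.

Lemma gen_atom i : is_atom (val i) -> gen i = 0.
Proof.
move=> ia; rewrite /gen -lock insubN // -[(_ < _)%N]/(_ < size vars)%N index_mem mem_vars.
by rewrite negbK.
Qed.

Lemma key_ltn j k : (key (elt k) < key (elt j))%N -> (j < k)%N.
Proof.
move=> kk; rewrite ltnNge; apply/negP => kj.
have tr : transitive (fun a b => key b <= key a)%N 
  by move=> a b e ab bc; exact: leq_trans bc ab.
have tot : total (fun a b => key b <= key a)%N by move=> a b; exact: leq_total.
have srt : sorted (fun a b => key b <= key a)%N vars by rewrite /vars -lock sort_sorted.
have := sorted_leq_nth tr (fun a => leqnn (key a)) (elt j) srt.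
move=> /(_ k j (ltn_ord k) (ltn_ord j) kj).
rewrite -!(tnth_nth _ (in_tuple vars)) -/(elt j) -/(elt k).
by rewrite leqNgt kk.
Qed.

Lemma key_lvl i g : (lvl (val i) < lvl (val g))%N -> (key i < key g)%N.
Proof.
move=> lt; apply: (@leq_trans ((lvl (val i)).+1 * (rank (\top : B)%O).+1)).
  by rewrite /key mulSn addnC ltn_add2r ltnS leq_subr.
by rewrite (leq_trans _ (leq_addr _ _)) // leq_mul2r lt orbT.
Qed.

Lemma key_rank i g : lvl (val i) = lvl (val g) -> (val i < val g)%O -> (key g < key i)%N.
Proof.
move=> E lt; rewrite /key E ltn_add2l; apply: ltn_sub2l (rank_lt lt).
exact: leq_trans (rank_lt lt) (rank_le (lex1 _)).
Qed.

Definition embed_tuple := [tuple hvar (elt j) | j < nv].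
Definition retract_tuple := [tuple gen (enum_val j) | j < nbidx B].

Definition embed : {rmorphism {mpoly int[nv]} -> {mpoly int[nbidx B]}} :=
  [the {rmorphism _ -> _} of comp_mpoly embed_tuple].
Definition retract : {rmorphism {mpoly int[nbidx B]} -> {mpoly int[nv]}} :=
  [the {rmorphism _ -> _} of comp_mpoly retract_tuple].
Definition FY_proj : {rmorphism {mpoly int[nbidx B]} -> FY B} :=
  [the {rmorphism _ -> _} of (\pi_{ideal_quot wond_idealr B})%qT].
Definition phi : {rmorphism {mpoly int[nv]} -> FY B} :=
  [the {rmorphism _ -> _} of FY_proj \o embed].

Lemma embedX j : embed 'X_j = hvar (elt j).
Proof. by rewrite /= comp_mpolyXU -tnth_nth tnth_mktuple. Qed.

Lemma retractX i : retract (hvar i) = gen i.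
Proof. by rewrite /= comp_mpolyXU -tnth_nth tnth_mktuple enum_rankK. Qed.

Lemma retract_embed p : retract (embed p) = p.
Proof.
apply: (rmorph_mpoly_eq (f := [the {rmorphism _ -> _} of retract \o embed])
  (g := [the {rmorphism _ -> _} of idfun])) => j.
by rewrite [LHS]/= -[comp_mpoly embed_tuple 'X_j]/(embed 'X_j) embedX
  -[comp_mpoly _ _]/(retract _) retractX gen_elt.
Qed.

Lemma phi_eq0 p : phi p = 0 <-> ideal_gen (@wond_relation d B) (embed p).
Proof. exact: FY_pi_eq0. Qed.

Lemma FY_proj_atom i : is_atom (val i) -> FY_proj (hvar i) = 0.
Proof.
move=> ia; apply/FY_pi_eq0; rewrite -[hvar i]mul1r.
exact/ideal_gen_mem/WondAtom.
Qed.

Lemma phi_gen i : phi (gen i) = FY_proj (hvar i).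
Proof.
have [ia|ia] := boolP (is_atom (val i)).
  by rewrite gen_atom // rmorph0 FY_proj_atom.
by have [j ->] := elt_onto ia; rewrite gen_elt -embedX.
Qed.

Lemma phi_retract q : phi (retract q) = FY_proj q.
Proof.
apply: (rmorph_mpoly_eq (f := [the {rmorphism _ -> _} of phi \o retract]) (g := FY_proj)) => j.
by rewrite -[LHS]/(phi (retract 'X_j)) -(enum_valK j) -/(hvar _) retractX phi_gen.
Qed.

Lemma phi_surj u : exists p, phi p = u.
Proof.
exists (retract (repr u)); rewrite phi_retract; exact: reprK.
Qed.

(** The defining products, once the variables of the atoms are set to 0. *)
Definition antichain_product (q : {mpoly int[nv]}) : Prop :=
  exists g A, [/\ antichain A, (\join_(a in A) val a)%O = val g &
    q = \prod_(a in A) (gen g - gen a)].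

Lemma phi_antichain q : antichain_product q -> phi q = 0.
Proof.
move=> [g [A [aA jA ->]]]; rewrite rmorph_prod.
under eq_bigr do rewrite rmorphB !phi_gen -rmorphB.
rewrite -rmorph_prod; apply/FY_pi_eq0; rewrite -[X in ideal_gen _ X]mul1r.
exact/ideal_gen_mem/WondAntichain.
Qed.

(** [retract] kills the variables of the atoms, maps the other relations to
    antichain products, and is a left inverse of [embed]. *)
Lemma phi_ideal p : phi p = 0 <-> ideal_gen antichain_product p.
Proof.
split=> [/phi_eq0 [r rS E]|[r rS ->]]; last first.
  rewrite rmorph_sum big_seq big1 // => a ar.
  by rewrite rmorphM (phi_antichain (rS a ar)) mulr0.
rewrite -(retract_embed p) E rmorph_sum big_seq.
apply: (big_ind (fun q => ideal_gen antichain_product q)).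
- exact: ideal_gen0.
- by move=> q q' qI q'I; rewrite -[q]mul1r; exact: ideal_gen_lin.
- move=> a /rS aS; rewrite rmorphM; case: aS => [i ia|g A aA jA].
    by rewrite retractX gen_atom // mulr0; exact: ideal_gen0.
  rewrite rmorph_prod; apply: ideal_gen_mem; exists g, A; split=> //.
  by apply: eq_bigr => i _; rewrite rmorphB !retractX.
Qed.

Lemma gen_homog i : gen i \is 1.-homog.
Proof.
have [ia|ia] := boolP (is_atom (val i)); first by rewrite gen_atom ?dhomog0.
by have [j ->] := elt_onto ia; rewrite gen_elt dhomogX /= mdeg1.
Qed.

Lemma genB_homog i g : gen i - gen g \is 1.-homog.
Proof. by rewrite dhomogD ?dhomogN ?gen_homog. Qed.

Lemma antichain_product_homog q : antichain_product q -> exists k, q \is k.-homog.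
Proof.
move=> [g [A [_ _ ->]]]; exists #|A|; rewrite -sum1_card.
apply: (big_ind2 (fun (q : {mpoly int[nv]}) k => q \is k.-homog)).
- exact: dhomog1.
- by move=> p1 k1 p2 k2; exact: dhomogM.
- by move=> a _; exact: genB_homog.
Qed.

Lemma phi_homogeneous : homogeneous_ideal (fun p => phi p = 0).
Proof.
move=> p k /phi_ideal [r rS ->]; rewrite linear_sum big_seq rmorph_sum big1 // => a ar.
have [e ae] := antichain_product_homog (rS a ar).
have [q qE] := pihomog_multiple k a.1 ae.
rewrite -[X in phi X]/(pihomog mdeg k (a.1 * a.2)) qE.
by rewrite rmorphM (phi_antichain (rS a ar)) mulr0.
Qed.

Lemma phi_weight j : FY_weight 1 (phi 'X_j).
Proof.
exists (hvar (elt j)); first by rewrite dhomogX /= mdeg1.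
by rewrite -gen_elt phi_gen.
Qed.

(** * Quadratic relations *)

Definition dominates i g : Prop := is_atom (val g) \/ (key g < key i)%N.

Definition nested_relations (R : comNzRingType) (f : I -> R) : Prop :=
  forall i g e, ~~ (val i <= val g)%O -> ~~ (val g <= val i)%O ->
    (val i `|` val g)%O = val e -> (f e - f i) * (f e - f g) = 0.

(** The product of [i] and [k] is then the leading monomial of a relation. *)
Definition reducible (R : comNzRingType) (f : I -> R) i k : Prop :=
  exists g g', [/\ dominates i g, dominates k g' & (f i - f g) * (f k - f g') = 0].

Lemma memberP x : x \in bset B -> exists i : I, val i = x.
Proof. by move=> xG; exists (exist _ x xG). Qed.

Let valG i : val i \in bset B := valP i.
Let val0 i : val i != \bot%O := building_neq0 bG (valP i).

Lemma join_trunc (x y : B) : x != \bot%O -> (y <= x)%O -> ~~ (y <= trunc fc x)%O ->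
  (y `|` trunc fc x)%O = x.
Proof.
move=> x0 yx yt; apply: rank_eq; first by rewrite leUx yx trunc_le.
rewrite (rank_trunc gL fc x0) rank_lt // lt_neqAle leUr andbT.
by apply: contraNneq yt => ->; rewrite leUl.
Qed.

Lemma truncP k : ~~ is_atom (val k) -> exists t, [/\ val t = trunc fc (val k),
  (lvl (val t) < lvl (val k))%N & dominates k t].
Proof.
move=> ka; have [t tE] := memberP (trunc_in gL bG fc (valG k) ka).
have lt : (lvl (val t) < lvl (val k))%N.
  by rewrite tE (lvlK fc (val0 _)) ltnS -(le_flag fc) leIr.
by exists t; split=> //; right; exact: key_lvl.
Qed.

Lemma dominates_same_level i e : lvl (val i) = lvl (val e) -> (val i < val e)%O ->
  dominates i e.
Proof. by move=> E lt; right; exact: key_rank. Qed.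

Section Reducible.
Variables (R : comNzRingType) (f : I -> R).
Hypothesis nested : nested_relations f.

(** The relation is that of [trunc i] and of an atom of [i] that is not below it. *)
Lemma reducible_square i : ~~ is_atom (val i) -> reducible f i i.
Proof.
move=> ia; have i0 := val0 i; have [t [tE tl it]] := truncP ia.
have [y [ya yi yt]] : exists y, [/\ is_atom y, (y <= val i)%O & ~~ (y <= trunc fc (val i))%O].
  apply: atom_separates => //; apply/negP => /rank_le.
  by rewrite (rank_trunc gL fc i0) ltnn.
have [a aE] := memberP (atom_in_building bG ya).
exists a, t; split=> //; first by left; rewrite aE.
apply: nested; rewrite ?aE ?tE ?join_trunc //.
apply: contra yt => ty; rewrite (rank_eq ty) //.
by rewrite (eqP ya) -tE rank_gt0.
Qed.

(** The relation is that of [i] and [trunc k], whose join is [k]. *)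
Lemma reducible_below i k : ~~ is_atom (val k) -> lvl (val i) = lvl (val k) ->
  (val i < val k)%O -> reducible f i k.
Proof.
move=> ka E ik; have [t [tE tl kt]] := truncP ka.
have it : ~~ (val i <= val t)%O by apply/negP => /(lvl_mono fc); rewrite E leqNgt tl.
exists k, t; split=> //; first exact: dominates_same_level.
rewrite -opprB mulNr nested ?oppr0 //.
  apply: contraL tl => ti; suff -> : val t = val i by rewrite E ltnn.
  apply: rank_eq => //; rewrite tE -ltnS -(rank_trunc gL fc (val0 k)).
  exact: rank_lt.
by rewrite tE join_trunc -?tE // ltW.
Qed.

Lemma reducible_sym i k : reducible f i k -> reducible f k i.
Proof. by move=> [g [g' [? ? E]]]; exists g', g; rewrite mulrC. Qed.

(** For incomparable members, [same_level_join] provides the relation. *)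
Lemma reducible_same_level i k : ~~ is_atom (val i) -> ~~ is_atom (val k) ->
  lvl (val i) = lvl (val k) -> reducible f i k.
Proof.
move=> ia ka E; have [<-|ik] := eqVneq i k; first exact: reducible_square.
have [lik|lik] := boolP (val i <= val k)%O.
  by apply: reducible_below => //; rewrite lt_neqAle lik andbT (inj_eq val_inj).
have [lki|lki] := boolP (val k <= val i)%O.
  apply/reducible_sym/reducible_below => //.
  by rewrite lt_neqAle lki andbT (inj_eq val_inj) eq_sym.
have [e eE] := memberP (same_level_join gL bG (valG i) (valG k) E).
have el : lvl (val e) = lvl (val i).
  apply/eqP; rewrite eqn_leq eE -(le_flag fc) leUx lvl_le [in c _]E lvl_le /=.
  by rewrite lvl_mono ?leUl.
exists e, e; split; last by rewrite -opprB mulNr -[X in _ * X]opprB mulrN opprK nested.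
- apply: dominates_same_level; rewrite ?el // eE lt_neqAle leUl andbT.
  by apply: contra lki => /eqP->; rewrite leUr.
- apply: dominates_same_level; rewrite ?el // eE lt_neqAle leUr andbT.
  by apply: contra lik => /eqP->; rewrite leUl.
Qed.

(** If [k] fails to be transverse to [trunc i], the member [z] given by
    [not_transverse] has the same join with [i] as [k], and the relations of the
    antichains [i, k] and [i, z] differ by a product of two linear forms. *)
Lemma reducible_incompatible i k : ~~ is_atom (val i) -> ~~ is_atom (val k) ->
  (lvl (val k) < lvl (val i))%N -> ~~ compatible fc (val i) (val k) ->
  reducible f i k.
Proof.
move=> ia ka; rewrite /compatible !negb_or negbK; set x := val k; set y := val i.
set a := trunc fc y => xy /and3P[xa xaG nt].
have xG : x \in bset B := valG _; have yG : y \in bset B := valG _.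
have y0 : y != \bot%O := val0 _.
have aG : a \in bset B := trunc_in gL bG fc yG ia.
have [z [zG zaE zlow]] := not_transverse gL bG xG ka xaG xa nt.
have a_y : (a <= y)%O := trunc_le _ _.
have low u : (u `|` a)%O = (x `|` a)%O ->
    [/\ ~~ (u <= y)%O, ~~ (y <= u)%O & (y `|` u)%O = (y `|` x)%O].
  move=> ua; have um : (u <= c (pred_lvl fc y))%O.
    apply: le_trans (leUl u a) _; rewrite ua leUx leIr andbT (le_flag fc).
    by rewrite -ltnS -lvlK.
  split.
  - apply: contra xa => uy; have ua' : (u <= a)%O by rewrite lexI uy.
    by rewrite (le_trans (leUl x a)) // -ua leUx ua' lexx.
  - by apply: contra (not_le_flag fc y0) => /le_trans; exact.
  - by rewrite -{1}(join_l a_y) -joinA (joinC a) ua (joinC x) joinA (join_l a_y).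
have [x1 x2 _] := low x erefl; have [z1 z2 zx] := low z zaE.
have yxG : (y `|` x)%O \in bset B.
  have -> : (y `|` x)%O = (y `|` (x `|` a))%O by rewrite (joinC x) joinA (join_l a_y).
  apply: join_in_building => //; rewrite -lt0x.
  apply: lt_le_trans (_ : a <= _)%O; first by rewrite lt0x (building_neq0 bG).
  by rewrite lexI a_y leUr.
have [e eE] := memberP yxG; have [t tE] := memberP zG.
have el : lvl (val e) = lvl y.
  apply/eqP; rewrite eqn_leq eE -(le_flag fc) leUx lvl_le (le_flag fc) (ltnW xy) /=.
  by rewrite lvl_mono ?leUl.
exists e, t; split.
- apply: dominates_same_level; rewrite ?el // eE lt_neqAle leUl andbT.
  by apply: contra x1 => /eqP yE; rewrite [leRHS](yE : y = _) leUr.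
- rewrite /dominates tE; case: zlow => [za|zx'|[zx' xz]]; [by left| |].
    by right; apply: key_lvl; rewrite tE.
  by right; apply: key_rank; rewrite tE.
have px : (f e - f i) * (f e - f k) = 0 by exact: nested.
have pz : (f e - f i) * (f e - f t) = 0.
  by apply: nested; rewrite ?tE // eE.
have -> : f k - f t = (f e - f t) - (f e - f k).
  by rewrite opprB [RHS]addrC addrA subrK.
by rewrite -opprB mulNr mulrBr px pz subrr oppr0.
Qed.

End Reducible.

Lemma key_elt_ltn j g : ~~ is_atom (val g) -> (key g < key (elt j))%N ->
  exists2 k, g = elt k & (j < k)%N.
Proof. by move=> /elt_onto[k ->] /key_ltn; exists k. Qed.

Lemma lead_genB j g : dominates (elt j) g ->
  mlead (gen (elt j) - gen g) = U_(j)%MM /\ mleadc (gen (elt j) - gen g) = 1.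
Proof.
rewrite gen_elt => jg; have [ga|ga] := boolP (is_atom (val g)).
  by rewrite (gen_atom ga) subr0 mleadXm mcoeffX eqxx.
case: jg => [ga'|gj]; first by rewrite ga' in ga.
have [k -> jk] := key_elt_ltn ga gj; rewrite gen_elt.
have kj : (U_(k)%MM < U_(j)%MM :> 'X_{1..nv})%O.
  apply/ltmcP; first by rewrite !mdeg1.
  exists j; last by rewrite !mnm1E eqxx -val_eqE /= gtn_eqF.
  by move=> e ej; rewrite !mnm1E -!val_eqE /= !gtn_eqF // (ltn_trans ej).
have lead : mlead ('X_j - 'X_k : {mpoly int[nv]}) = U_(j)%MM.
  by rewrite mleadDl ?mleadN ?mleadXm.
split=> //; rewrite lead mcoeffB !mcoeffX eqxx.
by move: kj; rewrite lt_neqAle => /andP[/negbTE-> _]; rewrite subr0.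
Qed.

Definition quadric j k (q : {mpoly int[nv]}) : Prop :=
  [/\ phi q = 0, q \is 2.-homog, mlead q = (U_(j) + U_(k))%MM & mleadc q = 1].

Lemma FY_nested : nested_relations (fun i => FY_proj (hvar i)).
Proof.
move=> i g e ig gi ige; have ig' : i \notin [set g].
  by rewrite inE; apply: contra ig => /eqP->.
rewrite -rmorphB -[X in _ * X]rmorphB -rmorphM; apply/FY_pi_eq0.
rewrite -[X in ideal_gen _ X]mul1r; apply: ideal_gen_mem.
have -> : (hvar e - hvar i) * (hvar e - hvar g) = \prod_(a in i |: [set g]) (hvar e - hvar a).
  by rewrite big_setU1 //= big_set1.
apply: WondAntichain.
- move=> a b; rewrite !inE => /orP[]/eqP-> /orP[]/eqP-> //.
  + by rewrite (negbTE ig).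
  + by rewrite (negbTE gi).
- by rewrite big_setU1 //= big_set1.
Qed.

Lemma quadric_reducible j k :
  reducible (fun i => FY_proj (hvar i)) (elt j) (elt k) -> exists q, quadric j k q.
Proof.
move=> [g [g' [/lead_genB[j1 j2] /lead_genB[k1 k2] E]]].
have [lead leadc] := mlead_mul1 j1 j2 k1 k2.
exists ((gen (elt j) - gen g) * (gen (elt k) - gen g')); split.
- apply: etrans (rmorph_prodB phi _ _ _ _) _.
  by rewrite (phi_gen (elt j)) (phi_gen g) (phi_gen (elt k)) (phi_gen g').
- exact: dhomogM (genB_homog _ _) (genB_homog _ _).
- exact: lead.
- exact: leadc.
Qed.

End Presentation.

Local Open Scope ring_scope.

(** * Divisibility of the leading monomials *)

Section Independence.
Context {d : Order.disp_t} (B : builtLattice d).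
Context (c : nat -> B) (n : nat) (fc : modular_flag (bset B) c n).
Let gL := built_geometric B.
Let bG := built_building B.
Local Notation I := (bidx B).
Local Notation lvl := (lvl fc).
Local Notation nv := (nv fc).
Local Notation elt := (@elt _ _ _ _ fc).
Local Notation phi := (phi fc).
Local Notation embed := (embed fc).
Let valI := val : I -> B.
Implicit Types (i g : I) (j k : 'I_nv) (m : 'X_{1..nv}) (p q : {mpoly int[nv]}).

Definition embed_mnm m : 'X_{1..nbidx B} := (\sum_j U_(enum_rank (elt j)) *+ m j)%MM.

Lemma embed_monomial m : embed 'X_[m] = 'X_[embed_mnm m].
Proof.
rewrite /= comp_mpolyX /embed_mnm -mprodXnE; apply: eq_bigr => j _.
by rewrite tnth_mktuple.
Qed.

Lemma mult_embed m i : mult (embed_mnm m) i = (\sum_j (elt j == i) * m j)%N.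
Proof.
rewrite /mult mnm_sumE; apply: eq_bigr => j _.
by rewrite mulmnE mnm1E (inj_eq enum_rank_inj).
Qed.

Lemma mult_embed_elt m j : mult (embed_mnm m) (elt j) = m j.
Proof.
rewrite mult_embed (bigD1 j) //= eqxx mul1n big1 ?addn0 // => k kj.
by rewrite (inj_eq (@elt_inj _ _ _ _ fc)) (negbTE kj).
Qed.

Lemma mult_embed_atom m i : is_atom (val i) -> mult (embed_mnm m) i = 0%N.
Proof.
move=> ia; rewrite mult_embed big1 // => j _; case: eqVneq => // ji.
by have := elt_not_atom j; rewrite ji ia.
Qed.

Lemma sum_mult_embed m : (\sum_i mult (embed_mnm m) i)%N = mdeg m.
Proof.
rewrite mdegE; under eq_bigr do rewrite mult_embed.
rewrite exchange_big; apply: eq_bigr => j _ /=.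
rewrite (bigD1 (elt j)) //= eqxx mul1n big1 ?addn0 // => i.
by rewrite eq_sym => /negbTE->.
Qed.

Section Chain.
Variable s : seq B.
Hypotheses (sp : path (<=%O : rel B) \bot%O s) (sl : last \bot%O s = \top%O).

Lemma chain_degree_ideal (q : {mpoly int[nbidx B]}) :
  ideal_gen (@wond_relation d B) q -> chain_degree valI s q = 0.
Proof.
move=> [r rS ->]; rewrite big_seq (big_morph _ (chain_degreeD valI s) (chain_degree0 valI s)).
rewrite big1 // => a /rS; case=> [i ia|g A _ jA].
  exact: (chain_degree_atom gL sl).
apply: (chain_degree_antichain gL sp sl) => //.
by apply: (building_neq0 bG); exact: (valP g).
Qed.

Lemma chain_degree_embed p : chain_degree valI s (embed p) =
  \sum_(m <- msupp p) p@_m *+ detects valI s (mult (embed_mnm m)).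
Proof.
rewrite {1}(mpolyE p) rmorph_sum (big_morph _ (chain_degreeD valI s) (chain_degree0 valI s)).
apply: eq_bigr => m _; have -> : embed (p@_m *: 'X_[m]) = p@_m *: embed 'X_[m].
  exact: comp_mpolyZ.
by rewrite embed_monomial chain_degreeZ chain_degreeX mulr_natr.
Qed.

End Chain.

(** The leading monomial of a relation is divisible by a leading monomial of
    degree 2: otherwise its support is the set detected by some chain, and the
    degree on that chain vanishes on every smaller monomial. *)
Lemma lead_divisible p : phi p = 0 -> p != 0 ->
  exists j k, (U_(j) + U_(k) <= mlead p)%MM /\ exists q, quadric j k q.
Proof.
move=> /phi_eq0 pI p0; set m := mlead p; apply: contrapT => none.
have {}none j k : (U_(j) + U_(k) <= m)%MM ->
    ~ reducible fc (fun i => FY_proj B (hvar i)) (elt j) (elt k).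
  by move=> jk /quadric_reducible[q qjk]; case: none; exists j, k; split=> //; exists q.
have nonatom := @elt_not_atom _ _ _ _ fc.
have m1 j : (m j <= 1)%N.
  rewrite leqNgt; apply/negP => mj; apply: (none j j).
    by apply/mnm_lepP => k; rewrite mnmDE mnm1E; case: eqP => // <-; exact: mj.
  by apply: (reducible_square fc (@FY_nested _ B)); exact: nonatom.
pose T : {set I} := [set i | 0 < mult (embed_mnm m) i]%N.
have TP i : i \in T -> exists2 j, i = elt j & (0 < m j)%N.
  rewrite inE => mi; have ia : ~~ is_atom (val i).
    by apply: contraTN mi => /(mult_embed_atom m)->.
  by have [j ij] := elt_onto fc ia; exists j; rewrite // -mult_embed_elt -ij.
have pair j k : j != k -> (0 < m j)%N -> (0 < m k)%N -> (U_(j) + U_(k) <= m)%MM.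
  move=> jk mj mk; apply/mnm_lepP => e; rewrite mnmDE !mnm1E.
  by have [<-|_] := eqVneq j e; [rewrite eq_sym (negbTE jk)|case: eqP => // <-].
have Tlvl : {in T &, injective (lvl \o valI)}.
  move=> _ _ /TP[j -> mj] /TP[k -> mk] /= jk; apply/eqP; apply: contraT => njk.
  have {}njk : j != k by apply: contra njk => /eqP->.
  case: (none j k (pair j k njk mj mk)).
  by apply: (reducible_same_level (@FY_nested _ B)) => //; exact: nonatom.
have Tcompat : {in T &, forall i g, (lvl (val g) < lvl (val i))%N ->
    compatible fc (val i) (val g)}.
  move=> _ _ /TP[j -> mj] /TP[k -> mk] lkj; apply: contraT => ncomp.
  have njk : j != k by apply: contraTneq lkj => ->; rewrite ltnn.
  case: (none j k (pair j k njk mj mk)).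
  by apply: (reducible_incompatible (@FY_nested _ B)) => //; exact: nonatom.
have [||||||||s [sp sl _ sur sat]] :=
  @chain_through _ _ gL _ bG c n fc n (valI @: T) [:: \top%O].
- by apply/subsetP => _ /imsetP[i _ ->]; exact: valP.
- by move=> _ /imsetP[_ /TP[j -> _] ->]; exact: nonatom.
- by move=> _ _ /imsetP[i iT ->] /imsetP[k kT ->] ik; congr valI; exact: Tlvl.
- by move=> _ _ /imsetP[i iT ->] /imsetP[k kT ->]; exact: Tcompat.
- by move=> t _; exact: lvl_len.
- by rewrite /= le0x.
- by rewrite /= (flagT fc).
- move=> _ /imsetP[_ /TP[j -> _] ->]; exists (\bot%O, \top%O); first exact: mem_head.
  by split; [exact: lex1|apply: (transverse_bot gL bG fc (valP (elt j))); exact: nonatom].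
rewrite (flagT fc) in sl.
have sur' : {in T, forall t, exists2 e, e \in steps \bot%O s & survives fc (valI t) e}.
  by move=> t tT; apply: sur; rewrite imset_f.
have valG i : valI i \in bset B by exact: valP.
have multE : mult (embed_mnm m) = indic T.
  apply/funext => i; rewrite /indic inE; have [ia|ia] := boolP (is_atom (val i)).
    by rewrite mult_embed_atom.
  by have [j ->] := elt_onto fc ia; rewrite mult_embed_elt; have := m1 j; case: (m j) => [|[]].
have := chain_degree_ideal sp sl pI; rewrite chain_degree_embed.
have mp : m \in msupp p by exact: mlead_supp.
rewrite (bigD1_seq m) ?msupp_uniq //= multE (detects_indic gL bG valG sp Tlvl sur' sat).
rewrite big_seq_cond big1 ?addr0; first by move/eqP; rewrite mulr1n mleadc_eq0 (negbTE p0).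
move=> m' /andP[m'p m'm]; rewrite [detects _ _ _](_ : _ = false) //.
have {m'm} lt : (m' < m)%O by rewrite lt_neqAle m'm msupp_le_mlead.
apply/negP => dm'.
have degE : mdeg m' = mdeg m.
  have := detects_total gL bG valG sp sl Tlvl sur' sat dm'.
  by rewrite -multE !sum_mult_embed.
have [j jeq jlt] := ltmcP degE lt.
have jT : elt j \in T by rewrite inE mult_embed_elt (leq_ltn_trans _ jlt).
have m'j : m' j = 0%N by have := m1 j; move: jlt; case: (m' j) => // e; case: (m j) => [|[]].
have same i : (key fc (elt j) < key fc i)%N -> mult (embed_mnm m') i = indic T i.
  move=> ij; have [ia|ia] := boolP (is_atom (val i)).
    by rewrite mult_embed_atom // -multE mult_embed_atom.
  have [k ik] := elt_onto fc ia; rewrite -multE ik !mult_embed_elt jeq //.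
  by apply: key_ltn; rewrite -ik.
apply: (negP (detects_leading gL bG valG sp sl Tlvl sur' sat jT _ _ _)) dm'.
- by rewrite mult_embed_elt.
- by move=> i ij; apply/same/key_lvl.
- move=> i il ij ne; rewrite same; last first.
    by apply: key_rank => //; rewrite lt_neqAle ij (inj_eq val_inj) ne.
  rewrite /indic; case: (boolP (i \in T)) => // iT.
  by case/eqP: ne; exact: Tlvl.
Qed.

Definition choose_quadric (jk : 'I_nv * 'I_nv) : option {mpoly int[nv]} :=
  if pselect (exists q, quadric jk.1 jk.2 q) is left e then Some (sval (cid e))
  else None.

Definition quadrics : seq {mpoly int[nv]} :=
  pmap choose_quadric (enum {: 'I_nv * 'I_nv}).

Lemma quadricsP q : q \in quadrics -> exists j k, quadric j k q.
Proof.
rewrite mem_pmap => /mapP[[j k] _]; rewrite /choose_quadric.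
by case: pselect => // e [->]; exists j, k; exact: (svalP (cid e)).
Qed.

Lemma mem_quadrics j k : (exists q, quadric j k q) ->
  exists2 q, q \in quadrics & quadric j k q.
Proof.
move=> e; exists (sval (cid e)); last exact: (svalP (cid e)).
rewrite mem_pmap; apply/mapP; exists (j, k); first by rewrite mem_enum.
rewrite /choose_quadric /=; case: pselect => // e'.
by congr (Some (sval (cid _))); exact: Prop_irrelevance.
Qed.

Definition deglex : rel 'X_{1..nv} := fun m1 m2 => (m1 <= m2)%O.

Lemma deglex_order : monomial_order deglex.
Proof.
split; [split|split].
- exact: lexx.
- exact: le_anti.
- exact: le_trans.
- exact: le_total.
- by move=> m; exact: le0x.
- by move=> m1 m2 m; rewrite /deglex lemc_add2l.
Qed.

Lemma lead_monomE p : lead_monom deglex p = mlead p.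
Proof.
rewrite /lead_monom /mlead; elim: (msupp p : seq _) => [|m r IH]; first by rewrite !big_nil.
by rewrite !big_cons IH joinEtotal /deglex maxElt leNgt; case: ltgtP.
Qed.

Lemma quadrics_groebner : groebner_basis deglex (fun p => phi p = 0) quadrics.
Proof.
split=> [q /quadricsP[j [k []]]//|q /quadricsP[j [k [_ _ _ q1]]]|p].
  by left; rewrite /lead_coeff lead_monomE.
split; apply: ideal_gen_sub => t [q []]; last first.
  move=> /quadricsP[j [k [qI _ _ q1]]] q0 ->; rewrite -[lead_term _ _]mul1r.
  by apply: ideal_gen_mem; exists q.
move=> qI q0 ->; have [j [k [jk /mem_quadrics[r rs [_ _ rl r1]]]]] := lead_divisible qI q0.
have -> : lead_term deglex q =
    (lead_coeff deglex q *: 'X_[mlead q - (U_(j) + U_(k))]) * lead_term deglex r.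
  rewrite /lead_term /lead_coeff !lead_monomE r1 scale1r rl -scalerAl -mpolyXD.
  by rewrite submK.
apply: ideal_gen_mem; exists r; split=> //.
by rewrite -mleadc_eq0 r1 oner_eq0.
Qed.

End Independence.

Theorem theorem1p3 (d : Order.disp_t) (B : builtLattice d)
    (ssB : supersolvable B) :
  admits_quadratic_groebner_basis (@FY_weight d B).
Proof.
case: ssB => C [maxC modC _ meetC].
have [c fc] := exists_modular_flag (built_geometric B) maxC modC meetC.
exists (nv fc), (phi fc); split.
- exact: phi_surj.
- exact: phi_weight.
- exact: phi_homogeneous.
exists (@deglex _ _ _ _ fc), (quadrics fc); split.
- exact: deglex_order.
- exact: quadrics_groebner.
- by move=> q /quadricsP[j [k []]].
Qed.
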